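(* For every integer $k \geq 2$ and every $\varepsilon > 0$, the number of chambers in the $k$-th Brillouin zone of $0 \in \mathbb{Z}^2$ is at least $\Omega(k^{1-\varepsilon})$ and at most $6k-6$. That is, for every $\varepsilon > 0$ there is a constant $c_\varepsilon > 0$ such that for all $k \geq 2$ the number of chambers $\chi_k$ satisfies $c_\varepsilon k^{1-\varepsilon} \leq \chi_k \leq 6k-6$.
   Context: For $a \in \mathbb{Z}^2 \setminus \{0\}$, the bisector of $0$ and $a$ is the line $\{x \in \mathbb{R}^2 : \|x\| = \|x-a\|\}$. The chambers of the arrangement of these bisectors are the closures of the connected components of the complement in $\mathbb{R}^2$ of the union of all bisectors. The $k$-th Brillouin zone of $0$ in $\mathbb{Z}^2$ is the set of $x \in \mathbb{R}^2$ such that $\|x-a\| < \|x\|$ for at most $k-1$ points $a \in \mathbb{Z}^2\setminus\{0\}$ and $\|x-b\| \leq \|x\|$ for at least $k-1$ points $b \in \mathbb{Z}^2 \setminus\{0\}$; it is the union of those chambers whose interior points are separated from $0$ by exactly $k-1$ bisectors, and these are its chambers. *)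

(* Defs.v *)
From HB Require Import structures.
From mathcomp Require Import all_boot all_order all_algebra.
From mathcomp Require Import finmap.
From mathcomp Require Import all_classical all_reals all_analysis.

Set Implicit Arguments.
Unset Strict Implicit.
Unset Printing Implicit Defensive.

Import Order.TTheory GRing.Theory Num.Theory.
Import numFieldNormedType.Exports.

Local Open Scope classical_set_scope.
Local Open Scope card_scope.
Local Open Scope ring_scope.

(* The norm that the library puts on row vectors is the sup norm; it induces
   the same topology as the Euclidean norm but not the same bisectors. *)
Definition enorm (R : realType) (x : 'rV[R]_2) : R :=
  Num.sqrt (\sum_(i < 2) x 0 i ^+ 2).

Definition lattice_pt (R : realType) (a : 'rV[int]_2) : 'rV[R]_2 :=
  map_mx intr a.
Arguments lattice_pt : clear implicits.

Definition bisector (R : realType) (a : 'rV[int]_2) : set 'rV[R]_2 :=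
  [set x | enorm x = enorm (x - lattice_pt R a)].
Arguments bisector : clear implicits.

Definition off_bisectors (R : realType) : set 'rV[R]_2 :=
  ~` \bigcup_(a in [set a | a != 0]) bisector R a.
Arguments off_bisectors : clear implicits.

Definition chambers (R : realType) : set (set 'rV[R]_2) :=
  [set closure (connected_component (off_bisectors R) x)
    | x in off_bisectors R].
Arguments chambers : clear implicits.

Definition brillouin_zone (R : realType) (k : nat) : set 'rV[R]_2 :=
  [set x |
    [set a | a != 0 /\ enorm (x - lattice_pt R a) < enorm x] #<= `I_k.-1 /\
    `I_k.-1 #<= [set b | b != 0 /\ enorm (x - lattice_pt R b) <= enorm x]].
Arguments brillouin_zone : clear implicits.

(* In the interior of a chamber both counts of [brillouin_zone] agree, so these
   are the chambers whose interior points are separated from 0 by exactly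
   k - 1 bisectors. *)
Definition brillouin_chambers (R : realType) (k : nat) : set (set 'rV[R]_2) :=
  [set C | chambers R C /\ C `<=` brillouin_zone R k].
Arguments brillouin_chambers : clear implicits.

(* Main.v *)
(* Cells of the bisector arrangement correspond to the sets of lattice points
   that are closer to an interior point than [0] is.  Rotating a line about the
   origin, every cell of level [l > 0] has a unique last vertex, and a vertex [p]
   with [j] lattice points strictly inside the circle around [p] through [0]
   and [m] bisectors through it is last for exactly one cell of each level [l]
   with [j < l < j + m].  So [chi_k] is the number of vertices with
   [j < k - 1 < j + m].

   Upper bound: sweeping instead with lines parallel to a fixed direction [e]
   gives a second count of the incidences between vertices and cells.  Summing
   the difference of the two counts over the levels below [k - 1] with weights
   [k - 1 - l], and averaging over the translations that move a lattice point of
   the circle to [0], yields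
   [\sum_p (k - 1 - j) (j + m - k + 1) / (m + 1) = 2 (k - 1)], where each summand
   is at least [1 / 3].

   Lower bound: each of the more than [c k] bisectors whose midpoint has level
   below [k - 1] contains a vertex with [j < k - 1 < j + m], and a vertex lies on
   at most [C k^eps] bisectors, because the number of representations of [n] as
   a sum of two squares is [O(n^delta)] for every [delta > 0]. *)

Require Import Defs.
From HB Require Import structures.
From mathcomp Require Import all_boot all_order all_algebra.
From mathcomp Require Import finmap.
From mathcomp Require Import all_classical all_reals all_analysis.
From mathcomp Require Import zify ring lra.

Set Implicit Arguments.
Unset Strict Implicit.
Unset Printing Implicit Defensive.

Import Order.TTheory GRing.Theory Num.Theory.
Import numFieldNormedType.Exports.

Local Open Scope fset_scope.
Local Open Scope ring_scope.

(** * Sums of two squares *)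

(** The weights replace each level [i] by the value [h(i) = max(0, k - 1 - i)] of a convex function.
    A vertex contributes [h(j) + h(j + m)] through its near and far cells, against
    [h(j + i) + h(j + m - i)] through the two cells that the line in direction [e] enters, where [i]
    lattice points of its circle lie on the side of [e]. These agree when [h] is affine on
    [[j, j + m]], so only the vertices to be counted leave a gap. For one vertex alone the gap may
    still vanish, namely for [i = 0] or [i = m]; moving each lattice point of the circle to the
    origin in turn makes [i] run once through [0, ..., m], and the mean gap is [a b / (a + b + 1)]
    with [a, b >= 1], which is least at [a = b = 1]. The right-hand side comes from a single cell:
    the one around the origin has no extremal vertex as seen from the origin, up to two in the
    parallel sweep, and weight [k - 1]. *)

Definition gnorm (z : int * int) : int := z.1 ^+ 2 + z.2 ^+ 2.

(** Pairs encode Gaussian integers: product here, conjugate below, norm above. *)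
Definition gmul (z w : int * int) : int * int :=
  (z.1 * w.1 - z.2 * w.2, z.1 * w.2 + z.2 * w.1).

Definition gconj (z : int * int) : int * int := (z.1, - z.2).

Lemma gnormM z w : gnorm (gmul z w) = gnorm z * gnorm w.
Proof. by rewrite /gnorm /=; ring. Qed.

Lemma gmulA z w t : gmul z (gmul w t) = gmul (gmul z w) t.
Proof. by rewrite /gmul /=; congr pair; ring. Qed.

Lemma gmulC z w : gmul z w = gmul w z.
Proof. by rewrite /gmul /=; congr pair; ring. Qed.

Definition int_range (n : nat) : seq int :=
  [seq i%:Z - n%:Z | i <- iota 0 (n.*2.+1)].

Lemma int_range_uniq n : uniq (int_range n).
Proof. by rewrite map_inj_uniq ?iota_uniq // => i j; lia. Qed.

Lemma mem_int_range n (i : int) : (i \in int_range n) = (`|i| <= n%:Z).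
Proof.
apply/mapP/idP => [[j] | hi]; first by rewrite mem_iota => ? ->; lia.
by exists (absz (i + n%:Z)); rewrite ?mem_iota; lia.
Qed.

Definition reps (n : nat) : seq (int * int) :=
  [seq z <- [seq (x, y) | x <- int_range n, y <- int_range n] | gnorm z == n%:Z].

Lemma reps_uniq n : uniq (reps n).
Proof.
rewrite filter_uniq // allpairs_uniq ?int_range_uniq //.
by move=> [? ?] [? ?].
Qed.

Lemma mem_reps n z : (z \in reps n) = (gnorm z == n%:Z).
Proof.
rewrite mem_filter andb_idr // => /eqP hz.
apply/allpairsP; exists z; rewrite !mem_int_range.
by move: hz; rewrite /gnorm; case: z => x y hz; split=> //; move: hz => /=; nia.
Qed.

Lemma size_reps1 : (size (reps 1) <= 4)%N.
Proof. by []. Qed.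

Lemma prime_dvdzM (p : nat) (x y : int) : prime p ->
  (p%:Z %| x * y)%Z = (p%:Z %| x)%Z || (p%:Z %| y)%Z.
Proof. by move=> pp; rewrite !dvdzE abszM /= Euclid_dvdM. Qed.

Lemma prime_dvdz_sqr (p : nat) (x : int) : prime p ->
  (p%:Z %| x ^+ 2)%Z = (p%:Z %| x)%Z.
Proof. by move=> pp; rewrite expr2 prime_dvdzM // orbb. Qed.

(** The last hypothesis says that [p] divides the imaginary part of [z] times the conjugate of [u].
    The norm of this product is divisible by [p], so its real part is divisible too, and [w] is the
    product divided by [p]. *)
Lemma gdvd_half (p : nat) (u z : int * int) : prime p -> gnorm u = p%:Z ->
  (p%:Z %| gnorm z)%Z -> (p%:Z %| z.1 * u.2 - z.2 * u.1)%Z ->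
  exists w, z = gmul u w.
Proof.
case: u z => a b [x y]; rewrite /gnorm /gmul /= => pp hu hz hd.
have p0 : p%:Z != 0 :> int by have := prime_gt0 pp; lia.
have /dvdzP[s hs] : (p%:Z %| x * a + y * b)%Z.
  rewrite -prime_dvdz_sqr //.
  have -> : (x * a + y * b) ^+ 2 = (x ^+ 2 + y ^+ 2) * (a ^+ 2 + b ^+ 2)
     - (x * b - y * a) * (x * b - y * a) by ring.
  by rewrite rpredB // dvdz_mulr.
case/dvdzP: hd => t ht.
exists (s, - t) => /=; congr pair; apply: (mulIf p0); rewrite -{1}hu.
  have -> : (a * s - b * - t) * p%:Z = a * (s * p%:Z) + b * (t * p%:Z) by ring.
  by rewrite -hs -ht; ring.
have -> : (a * - t + b * s) * p%:Z = b * (s * p%:Z) - a * (t * p%:Z) by ring.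
by rewrite -hs -ht; ring.
Qed.

(** Up to sign, the two factors below are the imaginary parts of [z] times the conjugate of [u] and
    of [z] times [u]. The prime [p] divides their product, hence one of them. *)
Lemma gdvd_prime (p : nat) (u z : int * int) : prime p -> gnorm u = p%:Z ->
  (p%:Z %| gnorm z)%Z -> exists w, z = gmul u w \/ z = gmul (gconj u) w.
Proof.
move=> pp hu hz.
have : (p%:Z %| (z.1 * u.2 - z.2 * u.1) * (z.1 * u.2 + z.2 * u.1))%Z.
  have -> : (z.1 * u.2 - z.2 * u.1) * (z.1 * u.2 + z.2 * u.1) =
    gnorm z * u.2 ^+ 2 - gnorm u * z.2 ^+ 2 by rewrite /gnorm; ring.
  by rewrite hu rpredB // dvdz_mulr.
rewrite prime_dvdzM // => /orP[] hd.
  by have [w ->] := gdvd_half pp hu hz hd; exists w; left.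
have hu' : gnorm (gconj u) = p%:Z by rewrite -hu /gnorm /=; ring.
have [|w ->] := gdvd_half pp hu' hz; last by exists w; right.
have -> : z.1 * (gconj u).2 - z.2 * (gconj u).1 = - (z.1 * u.2 + z.2 * u.1).
  by rewrite /=; ring.
by rewrite rpredN.
Qed.

Definition gpow (u : int * int) n := iter n (gmul u) (1, 0).

(** Each factor [p] of the norm splits off a factor [u] or its conjugate; by commutativity only the
    number [i] of factors [u] matters, which leaves [e + 1] choices. *)
Lemma gpow_factor (p : nat) (u : int * int) e (m : nat) z :
  prime p -> gnorm u = p%:Z -> gnorm z = (p ^ e * m)%N%:Z ->
  exists i w, [/\ (i <= e)%N, gnorm w = m%:Z &
    z = gmul (gmul (gpow u i) (gpow (gconj u) (e - i))) w].
Proof.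
move=> pp hu; have p0 : p%:Z != 0 :> int by have := prime_gt0 pp; lia.
have hu' : gnorm (gconj u) = p%:Z by rewrite -hu /gnorm /=; ring.
elim: e z => [|e IH] z hz.
  exists 0%N, z; split=> //; first by rewrite hz mul1n.
  by case: z {hz} => x y; rewrite /gmul /=; congr pair; ring.
have hd : (p%:Z %| gnorm z)%Z by rewrite hz expnS -mulnA PoszM dvdz_mulr.
have [w [] hw] := gdvd_prime pp hu hd.
  have : gnorm w = (p ^ e * m)%N%:Z.
    by apply: (mulfI p0); rewrite -{1}hu -gnormM -hw hz expnS -mulnA PoszM.
  move=> /IH[i [v [hi hv ew]]]; rewrite {}ew in hw; exists i.+1, v; split=> //.
  by rewrite hw !gmulA subSS.
have : gnorm w = (p ^ e * m)%N%:Z.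
  by apply: (mulfI p0); rewrite -{1}hu' -gnormM -hw hz expnS -mulnA PoszM.
move=> /IH[i [v [hi hv ew]]]; rewrite {}ew in hw; exists i, v; split=> //; first exact: leqW.
rewrite hw subSn //= !gmulA; congr gmul; congr gmul.
by rewrite -/(gpow _ _) gmulC.
Qed.

Lemma size_reps_split (p : nat) (u : int * int) e m :
  prime p -> gnorm u = p%:Z ->
  (size (reps (p ^ e * m)) <= e.+1 * size (reps m))%N.
Proof.
move=> pp hu.
set L := [seq gmul (gmul (gpow u i) (gpow (gconj u) (e - i))) w
            | i <- iota 0 e.+1, w <- reps m].
have <- : size L = (e.+1 * size (reps m))%N by rewrite size_allpairs size_iota.
apply: uniq_leq_size (reps_uniq _) _ => z; rewrite mem_reps => /eqP hz.
have [i [w [hi hw ->]]] := gpow_factor pp hu hz.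
by apply/allpairsP; exists (i, w); split=> //; rewrite ?mem_iota ?mem_reps ?hw //=.
Qed.

Lemma sqr_diff_ltn (i j t : nat) : (i < t)%N -> (j < t)%N ->
  (i%:Z - j%:Z) ^+ 2 <= (t.-1 ^ 2)%N%:Z.
Proof.
case: t => // t; rewrite !ltnS => hi hj; rewrite -mulnn PoszM /= expr2.
by nia.
Qed.

(* Thue's pigeonhole argument: two of the more than [p] values [i x - j y] with
   [0 <= i, j <= sqrt p] agree modulo [p]. *)
Lemma prime_dvd_gnorm (p : nat) (z : int * int) : prime p ->
  (forall u, gnorm u <> p%:Z) -> (p%:Z %| gnorm z)%Z ->
  (p%:Z %| z.1)%Z && (p%:Z %| z.2)%Z.
Proof.
case: z => x y pp hno; rewrite /gnorm /= => hd.
have p0 := prime_gt0 pp.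
have [hx|hx] := boolP (p%:Z %| x)%Z.
  rewrite -(prime_dvdz_sqr y pp) (_ : y ^+ 2 = x ^+ 2 + y ^+ 2 - x ^+ 2); last by ring.
  by rewrite rpredB // prime_dvdz_sqr.
exfalso.
have [t ht ht'] : exists2 t : nat, (p < t ^ 2)%N & (t.-1 ^ 2 < p)%N.
  have ex : exists t, (p < t ^ 2)%N by exists p.+1; nia.
  exists (ex_minn ex); first by case: ex_minnP.
  case: ex_minnP => -[|t] // ht hmin /=.
  rewrite ltnNge leq_eqVlt negb_or; apply/andP; split; last first.
    by apply/negP => /hmin; rewrite ltnn.
  apply/eqP => e; move: (pp); rewrite e => /primeP[_ /(_ t)].
  rewrite dvdn_exp // => /(_ isT); rewrite -mulnn in e *.
  by move=> /orP[] /eqP e2; move: (prime_gt1 pp); nia.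
pose f (ij : 'I_t * 'I_t) : 'I_p :=
  Ordinal (ltn_pmod (absz ((ij.1%:Z * x - ij.2%:Z * y) %% p)%Z) p0).
have /injectivePn : ~~ injectiveb f.
  apply/negP => /injectiveP /leq_card; rewrite card_prod !card_ord.
  by rewrite mulnn leqNgt ht.
case=> [[i j] [[i' j'] hne]] /(congr1 val) /=.
have pz : (0 < p%:Z) by lia.
have hm (w : int) : (absz (w %% p)%Z %% p)%N%:Z = (w %% p)%Z.
  by rewrite modn_small; [rewrite gez0_abs ?modz_ge0 //; lia|];
     have := ltz_pmod w pz; have := modz_ge0 w (lt0r_neq0 pz); lia.
move=> /(congr1 Posz); rewrite !hm => /eqP; rewrite eqz_mod_dvd.
set u := i%:Z - i'%:Z; set v := j%:Z - j'%:Z => h.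
have {}h : (p%:Z %| u * x - v * y)%Z.
  by rewrite (_ : _ - _ = i%:Z * x - j%:Z * y - (i'%:Z * x - j'%:Z * y)) // /u /v; ring.
have : (p%:Z %| (u ^+ 2 + v ^+ 2) * x ^+ 2)%Z.
  have -> : (u ^+ 2 + v ^+ 2) * x ^+ 2 =
     (u * x - v * y) * (u * x + v * y) + (x ^+ 2 + y ^+ 2) * v ^+ 2 by ring.
  by rewrite rpredD // dvdz_mulr.
rewrite prime_dvdzM // prime_dvdz_sqr // (negPf hx) orbF => /dvdzP[q hq].
have huv : (u != 0) || (v != 0).
  rewrite -negb_and; apply: contra hne => /andP[/eqP hu /eqP hv].
  rewrite xpair_eqE -!val_eqE /=.
  by move/subr0_eq: hu => [->]; move/subr0_eq: hv => [->]; rewrite !eqxx.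
have hub : u ^+ 2 <= (t.-1 ^ 2)%N%:Z by exact: sqr_diff_ltn.
have hvb : v ^+ 2 <= (t.-1 ^ 2)%N%:Z by exact: sqr_diff_ltn.
(* The sum [u ^+ 2 + v ^+ 2] is a positive multiple of [p] and at most twice [(t - 1)^2 < p], so it
   equals [p], against [hno]. *)
have q1 : q = 1.
  have hs : 0 < u ^+ 2 + v ^+ 2.
    by rewrite lt0r paddr_eq0 ?sqr_ge0 // !sqrf_eq0 negb_and huv addr_ge0 ?sqr_ge0.
  move: ht' hs hub hvb; rewrite hq; move: (t.-1 ^ 2)%N => T; clear -hq pz => h1 h2 h3 h4.
  by move: hq h3 h4; move: (u ^+ 2) (v ^+ 2) => U V hq h3 h4; nia.
by apply: (hno (u, v)); rewrite /gnorm /= hq q1 mul1r.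
Qed.

(** Every representation of a multiple of [p] is [p] times another one, so [e] drops by two at a
    time; for [e = 1] there is none, because [p] does not divide [m]. *)
Lemma size_reps_inert (p : nat) e m : prime p ->
  (forall u, gnorm u <> p%:Z) -> ~~ (p %| m)%N ->
  (size (reps (p ^ e * m)) <= size (reps m))%N.
Proof.
move=> pp hno pm; have p0 := prime_gt0 pp.
have key n z : z \in reps (p * n) ->
    exists2 w, z = gmul (p%:Z, 0) w & p%:Z * gnorm w = n%:Z.
  rewrite mem_reps => /eqP hz.
  have : (p%:Z %| gnorm z)%Z by rewrite hz PoszM dvdz_mulr.
  case/(prime_dvd_gnorm pp hno)/andP => /dvdzP[a ha] /dvdzP[b hb].
  exists (a, b).
    by case: z ha hb {hz} => x y /= -> ->; rewrite /gmul /=; congr pair; ring.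
  apply: (mulfI (_ : p%:Z != 0)); first by lia.
  by rewrite -PoszM -hz /gnorm /= ha hb; ring.
elim/ltn_ind: e => -[|[|e]] IH; first by rewrite mul1n.
  rewrite expn1; suff -> : reps (p * m) = [::] by [].
  case E: (reps (p * m)) => [|z s] //.
  have /key[w _ hw] : z \in reps (p * m) by rewrite E mem_head.
  by case/negP: pm; have : (p%:Z %| m%:Z)%Z by rewrite -hw dvdz_mulr.
apply: leq_trans (IH e _); last by [].
rewrite -[leqRHS](size_map (gmul (p%:Z, 0))).
apply: uniq_leq_size (reps_uniq _) _ => z; rewrite expnS -mulnA => /key[w -> hw].
apply: map_f; rewrite mem_reps; apply/eqP.
apply: (mulfI (_ : p%:Z != 0)); first by lia.
by rewrite hw expnS -mulnA PoszM.
Qed.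

Lemma size_reps_pfactor (p : nat) e m : prime p -> ~~ (p %| m)%N ->
  (size (reps (p ^ e * m)) <= e.+1 * size (reps m))%N.
Proof.
move=> pp pm.
have [/hasP[u]|/hasPn hno] := boolP (has predT (reps p)).
  by rewrite mem_reps => /eqP hu _; exact: size_reps_split hu.
apply: leq_trans (size_reps_inert e pp _ pm) _.
  by move=> u hu; have := hno u; rewrite mem_reps hu eqxx => /(_ isT).
by rewrite leq_pmull.
Qed.

(** With [q = e %/ M] one has [e + 1 <= (q + 1) M <= (M + 1) 2^q]; raise this to the power [M] and
    use [q M <= e]. *)
Lemma expn_bounded_geometric (M : nat) :
  exists2 K : nat, (0 < K)%N & forall e, (e.+1 ^ M <= K * 2 ^ e)%N.
Proof.
exists (M.+1 ^ M)%N; first by rewrite expn_gt0.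
move=> e; case: M => [|M]; first by rewrite !expn0 mul1n expn_gt0.
set N := M.+1.
have hlin : (e.+1 <= N.+1 * 2 ^ (e %/ N))%N.
  rewrite {1}(divn_eq e N); apply: (@leq_trans ((e %/ N).+1 * N)).
    by rewrite mulSn addnC -addSn leq_add2r ltn_mod.
  by rewrite mulnC leq_mul // ltn_expl.
apply: (@leq_trans ((N.+1 * 2 ^ (e %/ N)) ^ N)%N); first by rewrite leq_exp2r.
by rewrite expnMn leq_mul2l -expnM leq_exp2l // leq_trunc_div orbT.
Qed.

(** This is the bound [O(n^(1/M))] without real exponents. A prime power [p^e] multiplies the number
    of representations by at most [e + 1]. If [p >= 2^M], then [(e + 1)^M <= p^e] and no constant is
    lost; each smaller prime costs one factor [K]. *)
Lemma size_reps_bound (M : nat) : (0 < M)%N ->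
  exists2 C : nat, (0 < C)%N &
    forall n, (0 < n)%N -> (size (reps n) ^ M <= C * n)%N.
Proof.
move=> M0; have [K K0 hK] := expn_bounded_geometric M.
set B := (2 ^ M)%N.
(* The induction strips the least prime factor. All prime factors are at least [b], so at most
   [B - b] small primes remain to be paid for; the factor [4 ^ M] comes from the four
   representations of 1. *)
suff main n b : (0 < n)%N -> (forall p, prime p -> p %| n -> b <= p)%N ->
    (size (reps n) ^ M <= 4 ^ M * K ^ (B - b) * n)%N.
  exists (4 ^ M * K ^ B)%N; first by rewrite muln_gt0 !expn_gt0 K0.
  by move=> n n0; have := @main n 0%N n0 (fun _ _ _ => isT); rewrite subn0.
elim/ltn_ind: n b => n IH b n0 hb.
have [n1|n1] := leqP n 1.
  have -> : n = 1%N by lia.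
  have h4 : (size (reps 1) ^ M <= 4 ^ M)%N by rewrite leq_exp2r // size_reps1.
  by apply: leq_trans h4 _; rewrite muln1 leq_pmulr // expn_gt0 K0.
have pp := pdiv_prime n1; set p := pdiv n in pp *.
have [m pm hn] := pfactor_coprime pp n0.
set e := logn p n in hn.
have e0 : (0 < e)%N by rewrite logn_gt0 mem_primes pp n0 pdiv_dvd.
have pm' : ~~ (p %| m)%N by rewrite -prime_coprime.
have m0 : (0 < m)%N by rewrite hn muln_gt0 in n0; case/andP: n0.
have p1 := prime_gt1 pp.
have mn : (m < n)%N.
  by rewrite hn -[ltnLHS]muln1 ltn_pmul2l // -{1}(expn0 p) ltn_exp2l.
have hbm q : prime q -> (q %| m)%N -> (p.+1 <= q)%N.
  move=> pq qm; rewrite ltn_neqAle; apply/andP; split.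
    by apply: contraNneq pm' => ->.
  by apply: pdiv_min_dvd; [exact: prime_gt1 | rewrite hn dvdn_mulr].
have IHm := IH m mn p.+1 m0 hbm.
have bp : (b <= p)%N by apply: hb => //; exact: pdiv_dvd.
have hr : (size (reps n) ^ M <= e.+1 ^ M * size (reps m) ^ M)%N.
  by rewrite -expnMn leq_exp2r // hn mulnC size_reps_pfactor.
apply: leq_trans hr _.
apply: leq_trans (leq_mul (leqnn _) IHm) _.
have fin c d : (e.+1 ^ M <= c * p ^ e)%N -> (c * d <= K ^ (B - b))%N ->
    (e.+1 ^ M * (4 ^ M * d * m) <= 4 ^ M * K ^ (B - b) * n)%N.
  move=> h1 h2; rewrite hn.
  have -> : (4 ^ M * K ^ (B - b) * (m * p ^ e) =
             4 ^ M * m * (K ^ (B - b) * p ^ e))%N by ring.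
  have -> : (e.+1 ^ M * (4 ^ M * d * m) = 4 ^ M * m * (e.+1 ^ M * d))%N by ring.
  rewrite leq_mul2l; apply/orP; right.
  apply: leq_trans (leq_mul h1 (leqnn d)) _.
  by rewrite mulnAC leq_mul2r h2 orbT.
have [pB|pB] := ltnP p B.
  apply: (fin K).
    by apply: leq_trans (hK e) _; rewrite leq_mul2l leq_exp2r ?p1 ?orbT.
  by rewrite -expnS; apply: leq_pexp2l => //; lia.
apply: (fin 1%N).
  rewrite mul1n; apply: (@leq_trans (B ^ e)); last by rewrite leq_exp2r.
  by rewrite -expnM mulnC expnM leq_exp2r // ltn_expl.
by rewrite mul1n; apply: leq_pexp2l => //; lia.
Qed.

(** * Circles through the origin *)

Section Core.
Variable R : realType.
Implicit Types (x y p d : R * R) (a b : int * int) (A B : {fset int * int}).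

Definition emb a : R * R := (a.1%:~R, a.2%:~R).

Definition dot x a : R := x.1 * a.1%:~R + x.2 * a.2%:~R.

Definition crs x y : R := x.1 * y.2 - x.2 * y.1.

(* [pow x a = |x|^2 - |x - a|^2], so its sign tells on which side of the
   bisector of [0] and [a] the point [x] lies. *)
Definition pow x a : R := 2 * dot x a - (gnorm a)%:~R.

Definition along x d (t : R) : R * R := (x.1 + t * d.1, x.2 + t * d.2).

Lemma pow_along x d t a : pow (along x d t) a = pow x a + 2 * t * dot d a.
Proof. by rewrite /pow /dot /=; ring. Qed.

Lemma pow_sqr x a : pow x a =
  x.1 ^+ 2 + x.2 ^+ 2 - ((x.1 - a.1%:~R) ^+ 2 + (x.2 - a.2%:~R) ^+ 2).
Proof. by rewrite /pow /dot /gnorm; ring. Qed.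

Lemma pow0 x : pow x (0, 0) = 0.
Proof. by rewrite /pow /dot /gnorm /=; ring. Qed.

Lemma gnorm_eq0 a : (gnorm a == 0) = (a == (0, 0)).
Proof.
by case: a => a b; rewrite /gnorm paddr_eq0 ?sqr_ge0 // !sqrf_eq0 xpair_eqE.
Qed.

Lemma gnorm_ge0 a : 0 <= gnorm a.
Proof. by rewrite addr_ge0 ?sqr_ge0. Qed.

Lemma gnorm_gt0 a : a != (0, 0) -> 0 < (gnorm a)%:~R :> R.
Proof. by move=> a0; rewrite ltr0z lt0r gnorm_ge0 gnorm_eq0 a0. Qed.

Definition box (N : nat) : {fset int * int} :=
  seq_fset tt [seq (i, j) | i <- int_range N, j <- int_range N].

Lemma in_box N a : (a \in box N) = (`|a.1| <= N%:Z) && (`|a.2| <= N%:Z).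
Proof.
rewrite seq_fsetE; apply/allpairsP/andP => [[[u v] /= [hu hv ->]]|[h1 h2]].
  by rewrite -!mem_int_range.
by exists a; rewrite !mem_int_range; split=> //; case: a {h1 h2}.
Qed.

Lemma pow_ge0_box x a (N : nat) :
  2 * (`|x.1| + `|x.2|) <= N%:R -> 0 <= pow x a -> a \in box N.
Proof.
move=> hN; rewrite pow_sqr subr_ge0 => h.
have bnd (u w : R) : 0 <= u -> w ^+ 2 <= u ^+ 2 -> `|w| <= u.
  by move=> u0; rewrite -[w ^+ 2](real_normK (num_real _)) ler_sqr ?nnegrE.
have s0 : 0 <= `|x.1| + `|x.2| by rewrite addr_ge0.
have hs : x.1 ^+ 2 + x.2 ^+ 2 <= (`|x.1| + `|x.2|) ^+ 2.
  rewrite -[x.1 ^+ 2](real_normK (num_real _)) -[x.2 ^+ 2](real_normK (num_real _)).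
  have : 0 <= `|x.1| * `|x.2| by rewrite mulr_ge0.
  by move: (`|x.1|) (`|x.2|) => u v; nra.
have fin (u : R) (i : int) : `|u| <= `|x.1| + `|x.2| ->
    (u - i%:~R) ^+ 2 <= x.1 ^+ 2 + x.2 ^+ 2 -> `|i| <= N%:Z.
  move=> hu hi; have /(bnd _ _ s0) hi' := le_trans hi hs.
  rewrite -(ler_int R) intr_norm; apply: le_trans hN.
  have -> : i%:~R = u - (u - i%:~R) :> R by ring.
  by apply: le_trans (ler_normB _ _) _; lra.
rewrite in_box; apply/andP; split.
  apply: (fin x.1); first by rewrite lerDl.
  by apply: le_trans h; rewrite lerDl sqr_ge0.
apply: (fin x.2); first by rewrite lerDr.
by apply: le_trans h; rewrite lerDr sqr_ge0.
Qed.

Lemma in_sep (T : choiceType) (S : {fset T}) (P : pred T) (z : T) :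
  (z \in [fset t in S | P t]) = (z \in S) && P z.
Proof. by rewrite !inE. Qed.

Definition rad x : nat := Num.bound (2 * (`|x.1| + `|x.2|)).

(* The lattice points inside and on the circle with centre [x] through [0]: the
   point [x] has level [#|` In x|] and lies on [#|` On x|.-1] bisectors. *)
Definition In x := locked [fset a in box (rad x) | 0 < pow x a].
Definition On x := locked [fset a in box (rad x) | pow x a == 0].

Lemma rad_box x a : 0 <= pow x a -> a \in box (rad x).
Proof.
by apply: pow_ge0_box; apply/ltW/archi_boundP; rewrite mulr_ge0 // addr_ge0.
Qed.

Lemma in_In x a : (a \in In x) = (0 < pow x a).
Proof. by rewrite /In -lock in_sep andb_idl // => /ltW/rad_box. Qed.

Lemma in_On x a : (a \in On x) = (pow x a == 0).
Proof.
by rewrite /On -lock in_sep andb_idl // => /eqP h; apply: rad_box; rewrite h.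
Qed.



Lemma zero_On x : (0, 0) \in On x.
Proof. by rewrite in_On pow0. Qed.

Lemma zero_In x : ((0, 0) \in In x) = false.
Proof. by rewrite in_In pow0 ltxx. Qed.

Lemma On_dot x a : a \in On x -> 2 * dot x a = (gnorm a)%:~R.
Proof. by rewrite in_On subr_eq0 => /eqP. Qed.

Lemma On_dot_gt0 x a : a \in On x -> a != (0, 0) -> 0 < dot x a.
Proof. by move=> /On_dot h /gnorm_gt0; rewrite -h pmulr_rgt0. Qed.

Lemma small_pos (T : eqType) (s : seq T) (f g : T -> R) :
  exists2 e : R, 0 < e & forall z, z \in s -> 0 < f z -> e * `|g z| < f z.
Proof.
elim: s => [|w s [e e0 he]]; first by exists 1.
have [fw|fw] := leP (f w) 0.
  exists e => // z; rewrite inE => /orP[/eqP->|]; last exact: he.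
  by rewrite ltNge fw.
have gw : 0 < `|g w| + 1 by rewrite ltr_wpDl.
exists (Num.min e (f w / (`|g w| + 1))); first by rewrite lt_min e0 divr_gt0.
move=> z; rewrite inE => /orP[/eqP->|zs] fz.
  apply: (@le_lt_trans _ _ (f w / (`|g w| + 1) * `|g w|)).
    by rewrite ler_wpM2r // ge_min lexx orbT.
  by rewrite mulrAC ltr_pdivrMr // ltr_pM2l // ltrDl.
by apply: le_lt_trans (he z zs fz); rewrite ler_wpM2r // ge_min lexx.
Qed.

(** One [t0] has to serve infinitely many lattice points. For [t] in [[0, 1]] only points of one
    fixed box can have nonnegative power, and all others stay negative. *)
Lemma local_sign p d : exists2 t0 : R, 0 < t0 &
  forall t, 0 < t <= t0 -> forall a,
    (0 < pow p a -> 0 < pow (along p d t) a) /\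
    (pow p a < 0 -> pow (along p d t) a < 0).
Proof.
pose N := Num.bound (2 * ((`|p.1| + `|p.2|) + (`|d.1| + `|d.2|))).
have hN : 2 * ((`|p.1| + `|p.2|) + (`|d.1| + `|d.2|)) <= N%:R.
  by apply/ltW/archi_boundP; rewrite mulr_ge0 // !addr_ge0.
have far (t : R) a : 0 <= t <= 1 -> 0 <= pow (along p d t) a -> a \in box N.
  case/andP=> t0 t1; apply: pow_ge0_box; apply: le_trans hN.
  rewrite ler_pM2l //= -addrACA lerD //.
    by apply: le_trans (ler_normD _ _) _; rewrite lerD2l normrM ler_piMl // ger0_norm.
  by apply: le_trans (ler_normD _ _) _; rewrite lerD2l normrM ler_piMl // ger0_norm.
have [t0 t0_gt0 ht] :=
  small_pos (box N : seq _) (fun a => `|pow p a|) (fun a => 2 * dot d a).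
exists (Num.min t0 1) => [|t]; first by rewrite lt_min t0_gt0 ltr01.
rewrite le_min => /and3P[tgt tt0 t1] a.
have [aN|aN] := boolP (a \in box N); last first.
  split=> h.
    move: aN; rewrite (far 0) ?lexx ?ler01 //.
    by rewrite pow_along mulr0 mul0r addr0 ltW.
  rewrite ltNge; apply: contra aN; apply: far; rewrite t1 andbT; exact: ltW.
have key : pow p a != 0 -> `|2 * t * dot d a| < `|pow p a|.
  rewrite -normr_gt0 => /(ht a aN); apply: le_lt_trans.
  by rewrite mulrAC mulrC normrM (gtr0_norm tgt) ler_wpM2r.
rewrite pow_along; split=> h.
  by have := key (lt0r_neq0 h); rewrite (gtr0_norm h) ltr_norml => /andP[]; lra.
by have := key (ltr0_neq0 h); rewrite (ltr0_norm h) ltr_norml => /andP[]; lra.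
Qed.

(** The local picture at [p]: a direction [d] decides which lattice points of the circle become
    inner, and a [d] orthogonal to no nonzero one of them leads into a cell. *)
Lemma In_On_along p d : exists2 t0 : R, 0 < t0 & forall t, 0 < t <= t0 ->
  In (along p d t) = In p `|` [fset a in On p | 0 < dot d a] /\
  On (along p d t) = [fset a in On p | dot d a == 0].
Proof.
have [t0 t0_gt0 ht] := local_sign p d.
exists t0 => // t tt0; have := ht t tt0; case/andP: tt0 => tgt _ {}ht.
split; apply/fsetP => a; have [h1 h2] := ht a;
  rewrite ?in_fsetU ?in_sep ?in_In ?in_On;
  case: (ltgtP (pow p a) 0) h1 h2 => hp h1 h2 //=.
- by have := h2 isT; case: ltgtP.
- by rewrite h1.
- by rewrite pow_along hp add0r pmulr_rgt0 // mulr_gt0.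
- by have := h2 isT; case: ltgtP.
- by have := h1 isT; case: ltgtP.
- by rewrite pow_along hp add0r mulf_eq0 gt_eqF // mulr_gt0.
Qed.

(** If [x] is farther out, the disc around [x] through the origin contains the [M] by [M] block of
    lattice points that starts at the floor of [x]. Hence the region of bounded level is bounded,
    which gives compact cells and finitely many cells and vertices of each level. *)
Lemma norm_bound x (M : nat) : (#|` In x| < M ^ 2)%N ->
  x.1 ^+ 2 + x.2 ^+ 2 <= 2 * M%:R ^+ 2.
Proof.
apply: contraTT; rewrite -ltNge -leqNgt => h.
pose s := [seq (Num.floor x.1 + i%:Z, Num.floor x.2 + j%:Z) |
  i <- iota 0 M, j <- iota 0 M].
have us : uniq s.
  apply: allpairs_uniq; rewrite ?iota_uniq // => -[i j] [i' j'] _ _ /= [].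
  by move=> /addrI [->] /addrI [->].
have <- : size s = (M ^ 2)%N by rewrite size_allpairs !size_iota mulnn.
apply: uniq_leq_size us _ => a /allpairsP[[i j] /= [hi hj ->]].
have near (u : R) n : n \in iota 0 M ->
    (u - (Num.floor u + n%:Z)%:~R) ^+ 2 <= M%:R ^+ 2.
  rewrite mem_iota add0n => /= hn; rewrite -[X in X <= _](real_normK (num_real _)).
  rewrite ler_sqr ?nnegrE // ler_norml intrD -pmulrn.
  have /andP[h1 h2] := floor_itv u; rewrite intrD in h2.
  have : n%:R + 1 <= M%:R :> R by rewrite natr1 ler_nat.
  have : 0 <= n%:R :> R by [].
  lra.
rewrite in_In pow_sqr subr_gt0 /=; apply: le_lt_trans h.
by rewrite mulr_natl mulr2n lerD // near.
Qed.

Lemma pow_shift p v a : v \in On p ->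
  pow (p.1 - v.1%:~R, p.2 - v.2%:~R) a = pow p (a.1 + v.1, a.2 + v.2).
Proof.
move=> /On_dot h.
transitivity (pow p (a.1 + v.1, a.2 + v.2) - (2 * dot p v - (gnorm v)%:~R)).
  by rewrite /pow /dot /gnorm /=; ring.
by rewrite h subrr subr0.
Qed.

End Core.

(** * Cells and their extremal vertices *)

Section Cells.
Variable R : realType.
Implicit Types (x y p d : R * R) (a b t u : int * int) (A B : {fset int * int}).

Definition cell A x := In x = A /\ On x = [fset (0, 0)].

Definition closed_cell A y :=
  forall a, (a \in A -> 0 <= pow y a) /\ (a \notin A -> pow y a <= 0).

Lemma cellP A x : cell A x <-> (0, 0) \notin A /\ forall a, a != (0, 0) ->
  if a \in A then 0 < pow x a else pow x a < 0.
Proof.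
split=> [[<- hOn]|[h0 h]].
  split=> [|a a0]; first by rewrite zero_In.
  have : a \notin On x by rewrite hOn in_fset1.
  by rewrite in_On in_In; case: ltgtP.
split; apply/fsetP => a; rewrite ?in_In ?in_On ?in_fset1.
  have [->|a0] := eqVneq a (0, 0); first by rewrite pow0 ltxx (negPf h0).
  by have := h a a0; case: (a \in A) => // h1; rewrite ltNge ltW.
have [->|a0] := eqVneq a (0, 0); first by rewrite pow0 eqxx.
by have := h a a0; case: (a \in A) => h1; [rewrite gt_eqF | rewrite lt_eqF].
Qed.

Lemma cell_closed A x : cell A x -> closed_cell A x.
Proof.
case=> <- _ a; rewrite in_In; split; first exact: ltW.
by rewrite -leNgt.
Qed.

Lemma closed_cellE A p : closed_cell A p <->
  In p `<=` A /\ A `<=` In p `|` On p.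
Proof.
split=> [h|[/fsubsetP h1 /fsubsetP h2] a].
  split; apply/fsubsetP => a; rewrite ?in_fsetU ?in_In ?in_On; have [h1 h2] := h a.
    by move=> pa; apply: contraTT pa => /h2; rewrite -leNgt.
  by move=> /h1; rewrite le_eqVlt eq_sym orbC.
split=> [/h2|]; first by rewrite in_fsetU in_In in_On => /orP[/ltW//|/eqP->].
by apply: contraNle => pa; apply: h1; rewrite in_In.
Qed.

Lemma pow_mix y x (s : R) a :
  pow (along y (x.1 - y.1, x.2 - y.2) s) a = (1 - s) * pow y a + s * pow x a.
Proof. by rewrite /pow /dot /along /=; ring. Qed.

Lemma cell_mix A x y (s : R) : cell A x -> closed_cell A y -> 0 < s <= 1 ->
  cell A (along y (x.1 - y.1, x.2 - y.2) s).
Proof.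
move=> /cellP[h0 hx] hy /andP[s0 s1]; apply/cellP; split=> // a a0.
have s1' : 0 <= 1 - s by rewrite subr_ge0.
have := hx a a0; have [y1 y2] := hy a; rewrite pow_mix.
case: (boolP (a \in A)) => [/y1|/y2] ya xa.
  by rewrite ltr_wpDl ?mulr_ge0 ?mulr_gt0.
by rewrite -oppr_gt0 opprD -!mulrN ltr_wpDl ?mulr_ge0 ?mulr_gt0 ?oppr_ge0 ?oppr_gt0.
Qed.

Lemma cell_along A p d : closed_cell A p ->
  (forall a, a \in On p -> a != (0, 0) -> if a \in A then 0 < dot d a else dot d a < 0) ->
  (0, 0) \notin A ->
  exists2 s : R, 0 < s & cell A (along p d s).
Proof.
move=> hp hd A0; have [s s0 hs] := In_On_along p d; exists s => //.
have /hs[hI hO] : 0 < s <= s by rewrite s0 lexx.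
have z0 : dot d (0, 0) = 0 by rewrite /dot /= !mulr0 addr0.
have /closed_cellE[/fsubsetP h1 /fsubsetP h2] := hp.
split; [rewrite hI|rewrite hO]; apply/fsetP => a.
  rewrite in_fsetU in_sep; apply/orP/idP => [[/h1//|/andP[ha hda]]|ha].
    have [a0|a0] := eqVneq a (0, 0); first by rewrite a0 z0 ltxx in hda.
    by have := hd a ha a0; case: (a \in A) => // hda'; rewrite ltNge ltW in hda.
  have := h2 a ha; rewrite in_fsetU => /orP[|aO]; first by left.
  right; rewrite aO /=; have a0 : a != (0, 0) by apply: contraNneq A0 => <-.
  by have := hd a aO a0; rewrite ha.
rewrite in_sep in_fset1.
have [->|a0] := eqVneq a (0, 0); first by rewrite zero_On z0 eqxx.
apply/negbTE/nandP; case: (boolP (a \in On p)) => aO; last by left.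
right; have := hd a aO a0.
by case: (a \in A) => h; [rewrite gt_eqF | rewrite lt_eqF].
Qed.

(** The Binet-Cauchy identity. It converts signs of [dot d t] and [dot d u] into the angular order
    of [t] and [u], and back. *)
Lemma crs_lagrange p d t u : crs p d * crs (emb R t) (emb R u) =
  dot p t * dot d u - dot p u * dot d t.
Proof. by rewrite /crs /dot /emb /=; ring. Qed.

(* Seen from the origin, the closed cell of [A] lies on one side (given by the
   sign of [s]) of the line through [0] and [p]. *)
Definition extremal (s : R) A p :=
  closed_cell A p /\ forall y, closed_cell A y -> 0 <= s * crs p y.

Lemma continuous_pow a : continuous (fun y : R * R => pow y a).
Proof.
move=> y; rewrite /pow /dot; apply: cvgB; last exact: cvg_cst.
by apply: cvgMr; apply: cvgD; apply: cvgMl; [exact: cvg_fst|exact: cvg_snd].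
Qed.

Lemma closed_closed_cell A : closed (closed_cell A).
Proof.
have -> : closed_cell A = (\bigcap_a [set y | a \in A -> 0 <= pow y a] `&`
    \bigcap_a [set y | a \notin A -> pow y a <= 0])%classic.
  apply/seteqP; split=> y h; first by split=> a _ /=; have [] := h a.
  by move=> a; split; [apply: (h.1 a)|apply: (h.2 a)].
apply: closedI; apply: closed_bigI => a _.
  have [aA|aA] := boolP (a \in A).
    rewrite (_ : [set _ | _]%classic = ((fun y => pow y a) @^-1` [set r : R | 0 <= r])%classic).
      by apply: closed_comp; [move=> y _; exact: continuous_pow|exact: closed_ge].
    by apply/seteqP; split=> y /=; auto.
  rewrite (_ : [set _ | _]%classic = setT); first exact: closedT.
  by apply/seteqP; split=> y.
have [aA|aA] := boolP (a \notin A).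
  rewrite (_ : [set _ | _]%classic = ((fun y => pow y a) @^-1` [set r : R | r <= 0])%classic).
    by apply: closed_comp; [move=> y _; exact: continuous_pow|exact: closed_le].
  by apply/seteqP; split=> y /=; auto.
rewrite (_ : [set _ | _]%classic = setT); first exact: closedT.
by apply/seteqP; split=> y.
Qed.

Lemma closed_cell_bound A y :
  closed_cell A y -> y.1 ^+ 2 + y.2 ^+ 2 <= 2 * (#|` A|.+1)%:R ^+ 2.
Proof.
case/closed_cellE => /fsubset_leq_card h _; apply: norm_bound.
by apply: leq_ltn_trans h _; rewrite -mulnn; lia.
Qed.

Lemma compact_closed_cell A : compact (closed_cell A).
Proof.
pose M : R := 2 * (#|` A|.+1)%:R.
apply: (subclosed_compact (@closed_closed_cell A)).
  by apply: compact_setX; apply: (@segment_compact _ (- M) M).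
move=> y /closed_cell_bound h.
have M0 : 0 <= M by rewrite mulr_ge0.
have bnd (w : R) : w ^+ 2 <= M ^+ 2 -> (w \in `[- M, M]).
  move=> hw; rewrite in_itv /= -ler_norml -ler_sqr ?nnegrE //.
  by rewrite real_normK ?num_real.
have hM : y.1 ^+ 2 + y.2 ^+ 2 <= M ^+ 2.
  by apply: le_trans h _; rewrite exprMn ler_wpM2r ?sqr_ge0 // expr2; lra.
by split; apply: bnd; apply: le_trans hM; rewrite ?lerDl ?lerDr sqr_ge0.
Qed.

Lemma extremal_exists (s : R) A x : cell A x -> A != fset0 ->
  exists p, extremal s A p.
Proof.
move=> hx /fset0Pn[a aA].
have a0 : a != (0, 0) by case/cellP: hx => h _; apply: contraNneq h => <-.
have a2 := gnorm_gt0 R a0.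
have hdot y : closed_cell A y -> 0 < dot y a.
  move=> /(_ a)[/(_ aA) h _]; move: h a2; rewrite /pow; lra.
(* Up to the factor [s], this is the tangent of the angle from [y] to [a]; since [a] is in [A], the
   closed cell lies in the open half-plane [dot y a > 0], where the tangent is monotone in the
   angle. *)
pose f y := s * (crs y (emb R a) / dot y a).
have [||| p] := @compact_EVT_max _ R f (closed_cell A).
- by exists x; exact: cell_closed.
- exact: compact_closed_cell.
- apply: continuous_in_subspaceT => y /set_mem/hdot yA.
  apply: cvgMr; apply: cvgM; last first.
    apply: cvgV; first by rewrite gt_eqF.
    by apply: cvgD; apply: cvgMl; [exact: cvg_fst|exact: cvg_snd].
  by apply: cvgB; apply: cvgMl; [exact: cvg_fst|exact: cvg_snd].
move=> /set_mem pA hmax; exists p; split=> // y yA.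
have := hmax y (mem_set yA); rewrite /f.
have hp := hdot p pA; have hy := hdot y yA.
rewrite -subr_ge0 -mulrBr => h.
have e : crs p (emb R a) / dot p a - crs y (emb R a) / dot y a =
   crs p y * ((gnorm a)%:~R / (dot p a * dot y a)).
  rewrite -mulNr addf_div ?gt_eqF // mulrA; congr (_ / _).
  by rewrite /crs /dot /emb /gnorm /=; ring.
move: h; rewrite e mulrA pmulr_lge0 // divr_gt0 // mulr_gt0 //.
Qed.

(* The combinatorial form of extremality: in the angular order, the bisectors
   through [p] that separate the cell of [A] from [0] all come before, or all
   come after, the other bisectors through [p]. *)
Definition side (s : R) A p :=
  [/\ closed_cell A p, exists2 t, t \in On p & t \in A,
      exists2 u, u \in On p & (u != (0, 0)) && (u \notin A) &
      forall t u, t \in On p -> t \in A -> u \in On p -> u != (0, 0) ->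
        u \notin A -> s * crs (emb R t) (emb R u) < 0].

Lemma cell0 A x : cell A x -> (0, 0) \notin A.
Proof. by case/cellP. Qed.

Lemma side_exists (s : R) A x : s != 0 -> cell A x -> A != fset0 ->
  exists p, side s A p.
Proof.
move=> s0 hx An; have [p [pA hmax]] := extremal_exists s hx An.
have A0 := cell0 hx.
have [a aA] := fset0Pn _ An.
have p2 : 0 < p.1 ^+ 2 + p.2 ^+ 2.
  rewrite lt0r addr_ge0 ?sqr_ge0 // andbT.
  apply: contraTneq aA => /eqP; rewrite paddr_eq0 ?sqr_ge0 // !sqrf_eq0.
  move=> /andP[/eqP p1 /eqP p2].
  have [/(_ _) h _] := pA a; apply/negP => aA.
  have a0 : a != (0, 0) by apply: contraNneq A0 => <-.
  have := h aA; have := gnorm_gt0 R a0; rewrite /pow /dot p1 p2; lra.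
(* This is [p] turned by a right angle towards the forbidden side. If no circle point of [A]
   existed, a short move from [p] towards the origin with a small turn along [n] would stay in the
   cell; if all nonzero circle points were in [A], a move away from the origin would. Both
   contradict extremality. *)
pose n : R * R := (s * p.2, - (s * p.1)).
have [e e0 he] := small_pos (On p : seq _) (dot p) (dot n).
have turn (r : R) d : d = (r * p.1 + e * n.1, r * p.2 + e * n.2) ->
  ~ (forall a, a \in On p -> a != (0, 0) -> if a \in A then 0 < dot d a else dot d a < 0).
  move=> -> hd; have [w w0 /cell_closed/hmax] := cell_along pA hd A0.
  apply/negP; rewrite -ltNge.
  have -> : s * crs p (along p (r * p.1 + e * n.1, r * p.2 + e * n.2) w) =
    - (s ^+ 2 * w * e * (p.1 ^+ 2 + p.2 ^+ 2)) by rewrite /crs /along /n /=; ring.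
  by rewrite oppr_lt0 (pmulr_lgt0 _ p2) (pmulr_lgt0 _ e0) (pmulr_lgt0 _ w0) exprn_even_gt0.
have hdot r b : dot (r * p.1 + e * n.1, r * p.2 + e * n.2) b =
  r * dot p b + e * dot n b by rewrite /dot /=; ring.
have small b : b \in On p -> b != (0, 0) -> - dot p b < e * dot n b < dot p b.
  move=> bO b0; rewrite -ltr_norml normrM (gtr0_norm e0).
  by apply: he => //; exact: On_dot_gt0.
have exT : exists2 t, t \in On p & t \in A.
  apply: contrapT => no; apply: (turn (-1) _ erefl) => b bO b0.
  rewrite ifN; last by apply/negP => bA; apply: no; exists b.
  by rewrite hdot; have /andP[_] := small b bO b0; lra.
have exU : exists2 u, u \in On p & (u != (0, 0)) && (u \notin A).
  apply: contrapT => no; apply: (turn 1 _ erefl) => b bO b0.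
  rewrite ifT; last by apply/negPn/negP => bA; apply: no; exists b; rewrite ?b0.
  by rewrite hdot; have /andP[] := small b bO b0; lra.
exists p; split=> // t u tO tA uO u0 uA.
(* The direction from [p] to the interior point [x] has positive product with [t] and negative
   product with [u], and its position relative to [p] is known from extremality. *)
pose d : R * R := (x.1 - p.1, x.2 - p.2).
have t0 : t != (0, 0) by apply: contraNneq A0 => <-.
have hd b : b \in On p -> pow x b = 2 * dot d b.
  by move=> /On_dot h; rewrite /pow -h /d /dot /=; ring.
have /cellP[_ hx'] := hx.
have dt : 0 < dot d t by have := hx' t t0; rewrite tA hd // pmulr_rgt0.
have du : dot d u < 0 by have := hx' u u0; rewrite (negPf uA) hd // pmulr_rlt0.
have hpd : 0 <= s * crs p d.
  have := hmax x (cell_closed hx); suff -> : crs p x = crs p d by [].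
  by rewrite /crs /=; ring.
have pt := On_dot_gt0 tO t0; have pu := On_dot_gt0 uO u0.
rewrite ltNge; apply/negP => h.
have := mulr_ge0 hpd h; rewrite mulrACA crs_lagrange -expr2.
rewrite pmulr_rge0 ?exprn_even_gt0 // subr_ge0 leNgt => /negP; apply.
by apply: (@lt_trans _ _ 0); [rewrite pmulr_rlt0|rewrite mulr_gt0].
Qed.

Lemma side_extremal (s : R) A p : s != 0 -> (0, 0) \notin A ->
  side s A p -> extremal s A p.
Proof.
move=> s0 A0 [pA [t tO tA] [u uO /andP[u0 uA]] h]; split=> // y yA.
have t0 : t != (0, 0) by apply: contraNneq A0 => <-.
have pt := On_dot_gt0 tO t0; have pu := On_dot_gt0 uO u0.
pose d : R * R := (y.1 - p.1, y.2 - p.2).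
have hd b : b \in On p -> pow y b = 2 * dot d b.
  by move=> /On_dot h'; rewrite /pow -h' /d /dot /=; ring.
have dt : 0 <= dot d t by have [/(_ tA)] := yA t; rewrite hd // pmulr_rge0.
have du : dot d u <= 0 by have [_ /(_ uA)] := yA u; rewrite hd // pmulr_rle0.
have -> : crs p y = crs p d by rewrite /crs /=; ring.
have := h t u tO tA uO u0 uA; move=> htu; rewrite leNgt; apply/negP => hn.
have : 0 < (s * crs p d) * (s * crs (emb R t) (emb R u)) by rewrite nmulr_lgt0.
rewrite mulrACA crs_lagrange -expr2 pmulr_rgt0 ?exprn_even_gt0 // subr_gt0.
apply/negP; rewrite -leNgt.
by apply: (@le_trans _ _ 0); [rewrite pmulr_rle0|rewrite mulr_ge0 // ltW].
Qed.

(** Extremality of both points puts [q] on the line through the origin and [p]. The identity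
    [crs_lagrange] then makes [q - p] orthogonal to both [t] and [u], which are linearly
    independent. *)
Lemma side_uniq (s : R) A p q : s != 0 -> (0, 0) \notin A ->
  side s A p -> side s A q -> p = q.
Proof.
move=> s0 A0 hp hq.
have [_ ep] := side_extremal s0 A0 hp; have [_ eq] := side_extremal s0 A0 hq.
have [pA [t tO tA] [u uO /andP[u0 uA]] h] := hp; have [qA _ _ _] := hq.
have t0 : t != (0, 0) by apply: contraNneq A0 => <-.
have pt := On_dot_gt0 tO t0; have pu := On_dot_gt0 uO u0.
pose d : R * R := (q.1 - p.1, q.2 - p.2).
have hd b : b \in On p -> pow q b = 2 * dot d b.
  by move=> /On_dot h'; rewrite /pow -h' /d /dot /=; ring.
have dt : 0 <= dot d t by have [/(_ tA)] := qA t; rewrite hd // pmulr_rge0.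
have du : dot d u <= 0 by have [_ /(_ uA)] := qA u; rewrite hd // pmulr_rle0.
have c0 : crs p d = 0.
  have -> : crs p d = crs p q by rewrite /crs /=; ring.
  have := ep q qA; have := eq p pA.
  have -> : crs q p = - crs p q by rewrite /crs; ring.
  rewrite mulrN oppr_ge0 => h1 h2; apply: (mulfI s0); rewrite mulr0.
  by apply/eqP; rewrite eq_le h1 h2.
have ctu : crs (emb R t) (emb R u) != 0.
  by have := h t u tO tA uO u0 uA; apply: contraTneq => ->; rewrite mulr0 ltxx.
have := crs_lagrange p d t u; rewrite c0 mul0r => /esym/eqP; rewrite subr_eq0.
move=> /eqP e.
have e1 : dot p t * dot d u <= 0 by rewrite pmulr_rle0.
have e2 : 0 <= dot p u * dot d t by rewrite mulr_ge0 // ltW.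
have du0 : dot d u = 0.
  by apply/eqP; rewrite -(mulrI_eq0 _ (mulfI (lt0r_neq0 pt))) eq_le e1 e e2.
have dt0 : dot d t = 0.
  by apply/eqP; rewrite -(mulrI_eq0 _ (mulfI (lt0r_neq0 pu))) eq_le e2 -e e1.
have d1 : d.1 * crs (emb R t) (emb R u) = dot d t * u.2%:~R - dot d u * t.2%:~R.
  by rewrite /crs /dot /=; ring.
have d2 : d.2 * crs (emb R t) (emb R u) = dot d u * t.1%:~R - dot d t * u.1%:~R.
  by rewrite /crs /dot /=; ring.
rewrite du0 dt0 !mul0r subrr in d1 d2.
move/eqP: d1; move/eqP: d2; rewrite !mulf_eq0 (negPf ctu) !orbF !subr_eq0 /=.
by case: p q {hp hq ep eq pA tO uO h qA pt pu d hd dt du c0 e e1 e2 du0 dt0}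
  => p1 p2 [q1 q2] /= /eqP -> /eqP ->.
Qed.

(** On the circle, both sets are cut off from the same end of the angular order, so they are nested
    and their size decides. Otherwise some [a] and [b] would each have to precede the other. *)
Lemma side_inj (s : R) A B p : (0, 0) \notin A -> (0, 0) \notin B ->
  #|` A| = #|` B| -> side s A p -> side s B p -> A = B.
Proof.
move=> A0 B0 hc [hA _ _ sA] [hB _ _ sB].
have cross C D a : closed_cell C p -> closed_cell D p -> (0, 0) \notin C ->
    a \in C -> a \notin D -> (a \in On p) && (a != (0, 0)).
  move=> hC hD C0 aC aD.
  have [/(_ aC) h1 _] := hC a; have [_ /(_ aD) h2] := hD a.
  by rewrite in_On eq_le h1 h2; apply: contraNneq C0 => <-.
have [AB|/fsubsetPn[a aA aB]] := boolP (A `<=` B).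
  by apply/eqP; rewrite eqEfcard AB hc leqnn.
have [BA|/fsubsetPn[b bB bA]] := boolP (B `<=` A).
  by apply/esym/eqP; rewrite eqEfcard BA hc leqnn.
have /andP[aO a0] := cross A B a hA hB A0 aA aB.
have /andP[bO b0] := cross B A b hB hA B0 bB bA.
have h1 := sA a b aO aA bO b0 bA; have h2 := sB b a bO bB aO a0 aB.
have : crs (emb R a) (emb R b) = - crs (emb R b) (emb R a) by rewrite /crs; ring.
by move=> e; move: h1; rewrite e mulrN oppr_lt0 ltNge ltW.
Qed.

Lemma side_opp (s : R) A p : side s A p -> ~ side (- s) A p.
Proof.
move=> [_ [t tO tA] [u uO /andP[u0 uA]] h] [_ _ _ h'].
have h1 := h t u tO tA uO u0 uA; have := h' t u tO tA uO u0 uA.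
by rewrite mulNr oppr_lt0 ltNge ltW.
Qed.

End Cells.

(** * Cells around a vertex: rotating lines and parallel lines *)

Section Vertices.
Variable R : realType.
Implicit Types (x y p q d e : R * R) (a b t u : int * int) (A B : {fset int * int}).

Lemma card_sep (T : choiceType) (S : {fset T}) (P : pred T) :
  #|` [fset z in S | P z]| = count P S.
Proof.
rewrite -size_filter; apply/perm_size/uniq_perm; rewrite ?filter_uniq //.
by move=> z; rewrite in_sep mem_filter andbC.
Qed.

Lemma threshold (s : seq R) (i : nat) : uniq s -> (0 < i < size s)%N ->
  exists2 c : R, count (fun r => r < c) s = i & c \notin s.
Proof.
move=> us /andP[i0 isz]; pose s' := sort <=%R s.
have ss : sorted <=%R s' by apply: sort_sorted; exact: le_total.
have ps : perm_eq s' s by rewrite perm_sort.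
have szs : size s' = size s by rewrite size_sort.
have us' : uniq s' by rewrite (perm_uniq ps).
have i1 : (i.-1 < size s')%N by rewrite szs; lia.
have i2 : (i < size s')%N by rewrite szs.
have mono j k : (j <= k)%N -> (k < size s')%N -> nth 0 s' j <= nth 0 s' k.
  move=> jk ks; apply: (sorted_leq_nth le_trans (@lexx _ _) 0 ss) => //.
  by rewrite inE (leq_ltn_trans jk).
have lt_i : nth 0 s' i.-1 < nth 0 s' i.
  rewrite lt_neqAle mono ?leq_pred // andbT nth_uniq //; lia.
pose c := (nth 0 s' i.-1 + nth 0 s' i) / 2.
have [c1 c2] : nth 0 s' i.-1 < c /\ c < nth 0 s' i by rewrite /c; split; lra.
have lo j : (j < i)%N -> nth 0 s' j < c.
  by move=> ji; apply: le_lt_trans c1; apply: mono => //; lia.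
have hi j : (i <= j)%N -> (j < size s')%N -> c < nth 0 s' j.
  by move=> ij js; apply: lt_le_trans c2 _; apply: mono.
exists c; last first.
  rewrite -(perm_mem ps); apply/negP => /(nthP 0)[j js ej].
  by have [/lo|/hi/(_ js)] := ltnP j i; rewrite ej ltxx.
rewrite -(permP ps) -(cat_take_drop i s') count_cat.
have -> : count (fun r => r < c) (drop i s') = 0%N.
  apply/eqP; rewrite -leqn0 leqNgt -has_count; apply/negP.
  move=> /(has_nthP 0)[j]; rewrite size_drop nth_drop => js.
  by apply/negP; rewrite -leNgt ltW // hi ?leq_addr // -ltn_subRL.
rewrite addn0 -[RHS](size_takel (ltnW i2)).
apply/eqP; rewrite -all_count; apply/(all_nthP 0) => j.
by rewrite size_takel ?(ltnW i2) // => ji; rewrite nth_take // lo.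
Qed.

(** A line through the origin meets a circle through the origin in at most one further point. *)
Lemma On_crs p a b : a \in On p -> b \in On p -> a != (0, 0) -> b != (0, 0) ->
  crs (emb R a) (emb R b) = 0 -> a = b.
Proof.
move=> /On_dot ha /On_dot hb a0 b0 h.
have a2 := gnorm_gt0 R a0; have b2 := gnorm_gt0 R b0.
have e1 : (gnorm a)%:~R * b.1%:~R = (gnorm b)%:~R * a.1%:~R :> R.
  rewrite -ha -hb; apply/eqP; rewrite -subr_eq0; apply/eqP.
  transitivity (- (2 * p.2) * crs (emb R a) (emb R b)); last by rewrite h mulr0.
  by rewrite /dot /crs /emb /=; ring.
have e2 : (gnorm a)%:~R * b.2%:~R = (gnorm b)%:~R * a.2%:~R :> R.
  rewrite -ha -hb; apply/eqP; rewrite -subr_eq0; apply/eqP.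
  transitivity ((2 * p.1) * crs (emb R a) (emb R b)); last by rewrite h mulr0.
  by rewrite /dot /crs /emb /=; ring.
have e : (gnorm a)%:~R = (gnorm b)%:~R :> R.
  apply: (mulfI (lt0r_neq0 a2)); apply: (mulIf (lt0r_neq0 b2)).
  transitivity (((gnorm a)%:~R * b.1%:~R) ^+ 2 + ((gnorm a)%:~R * b.2%:~R) ^+ 2 : R).
    by rewrite {3}/gnorm; ring.
  by rewrite e1 e2 {3}/gnorm; ring.
rewrite e in e1 e2; move/(mulfI (lt0r_neq0 b2)): e1; move/(mulfI (lt0r_neq0 b2)): e2.
by move=> /intr_inj e2 /intr_inj e1; case: a b e1 e2 {ha hb a0 b0 h a2 b2 e}
  => a1 a2 [b1 b2] /= -> ->.
Qed.

Lemma On_crs_slope p a b : (p.1 ^+ 2 + p.2 ^+ 2) * crs (emb R a) (emb R b) =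
  dot p a * crs p (emb R b) - dot p b * crs p (emb R a).
Proof. by rewrite /dot /crs /emb /=; ring. Qed.

Lemma On_norm_gt0 p a : a \in On p -> a != (0, 0) -> 0 < p.1 ^+ 2 + p.2 ^+ 2.
Proof.
move=> aO a0; rewrite lt0r addr_ge0 ?sqr_ge0 // andbT.
apply: contraTneq (On_dot_gt0 aO a0) => /eqP; rewrite paddr_eq0 ?sqr_ge0 // !sqrf_eq0 /dot.
by move=> /andP[/eqP -> /eqP ->]; rewrite !mul0r addr0 ltxx.
Qed.

Lemma side_realize p (l : nat) : (#|` In p| < l)%N -> (l.+1 < #|` In p| + #|` On p|)%N ->
  exists A x, [/\ cell A x, #|` A| = l & side (-1) A p].
Proof.
move=> hl1 hl2; pose S := On p `\ (0, 0).
have cS : #|` On p| = #|` S|.+1 by rewrite (cardfsD1 (0, 0)) zero_On.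
have inS a : (a \in S) = (a != (0, 0)) && (a \in On p) by rewrite in_fsetD1.
(* The tangent of the angle from [p] to [a] orders the circle points. The set [A] is to contain the
   [i] lowest; the direction [d] below satisfies [0 < dot d a] exactly when [k a < c]. *)
pose k a := crs p (emb R a) / dot p a.
have kinj : {in S &, injective k}.
  move=> a b; rewrite !inS => /andP[a0 aO] /andP[b0 bO] h.
  apply: (On_crs aO bO) => //; apply/eqP; have p2 := On_norm_gt0 aO a0.
  rewrite -(mulrI_eq0 _ (mulfI (lt0r_neq0 p2))) On_crs_slope subr_eq0; apply/eqP.
  have pa := On_dot_gt0 aO a0; have pb := On_dot_gt0 bO b0.
  move/eqP: h; rewrite /k eqr_div ?(lt0r_neq0 pa) ?(lt0r_neq0 pb) // => /eqP h.
  by rewrite mulrC -h mulrC.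
pose i := (l - #|` In p|)%N.
have hi : (0 < i < #|` S|)%N.
  by move: hl1 hl2; rewrite cS /i; move: #|` In p| #|` S| => m n; lia.
have [||c hc cn] := @threshold [seq k a | a <- S] i.
- by rewrite map_inj_in_uniq ?fset_uniq.
- by rewrite size_map.
pose d : R * R := (c * p.1 + p.2, c * p.2 - p.1).
have hd a : dot d a = c * dot p a - crs p (emb R a) by rewrite /dot /crs /=; ring.
have hdk a : a \in S -> (0 < dot d a) = (k a < c).
  rewrite inS => /andP[a0 aO]; rewrite hd subr_gt0.
  by rewrite /k ltr_pdivrMr // On_dot_gt0.
have [s s0 hs] := In_On_along p d.
have /hs[hI hO] : 0 < s <= s by rewrite s0 lexx.
pose A := In p `|` [fset a in On p | 0 < dot d a].
have z0 : dot d (0, 0) = 0 by rewrite /dot /= !mulr0 addr0.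
have dn0 a : a \in S -> dot d a != 0.
  move=> aS; apply: contra cn; rewrite hd subr_eq0 => /eqP h.
  apply/mapP; exists a => //; move: aS; rewrite inS => /andP[a0 aO].
  by rewrite /k -h mulfK // gt_eqF // On_dot_gt0.
have Acell : cell A (along p d s).
  split; rewrite ?hI ?hO //; apply/fsetP => a; rewrite in_sep in_fset1.
  have [->|a0] := eqVneq a (0, 0); first by rewrite zero_On z0 eqxx.
  by apply/negbTE/nandP; case: (boolP (a \in On p)) => aO; [right; rewrite dn0 // inS a0|left].
have inA a : a \in On p -> (a \in A) = (0 < dot d a).
  move=> aO; rewrite in_fsetU in_sep aO /= in_In.
  by move: aO; rewrite in_On => /eqP ->; rewrite ltxx.
have pcl : closed_cell A p.
  apply/closed_cellE; rewrite fsubsetUl; split=> //; apply: fsetUS.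
  by apply/fsubsetP => a; rewrite in_sep => /andP[].
have cA : #|` A| = l.
  rewrite cardfsU (_ : _ `&` _ = fset0) ?cardfs0 ?subn0.
    rewrite card_sep; suff -> : count (fun a => 0 < dot d a) (On p) = i by rewrite /i; lia.
    rewrite -hc count_map -!card_sep; congr #|` _|; apply/fsetP => a.
    rewrite !in_sep /= inS; have [->|a0] := eqVneq a (0, 0).
      by rewrite z0 ltxx andbF.
    by case: (boolP (a \in On p)) => aO //=; rewrite hdk // inS a0.
  apply/fsetP => a; rewrite in_fsetI in_sep in_In in_On in_fset0.
  by case: ltgtP.
have hlt : (0 < i < size [seq k a | a <- S])%N by rewrite size_map.
exists A, (along p d s); split=> //; split=> //.
- have : has (fun r => r < c) [seq k a | a <- S].
    by rewrite has_count hc; case/andP: hlt.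
  case/hasP => _ /mapP[t tS ->] kt; move: (tS); rewrite inS => /andP[_ tO].
  by exists t => //; rewrite inA // hdk.
- have : ~~ all (fun r => r < c) [seq k a | a <- S].
    by rewrite all_count hc neq_ltn; case/andP: hlt => _ ->.
  case/allPn => _ /mapP[u uS ->] ku; move: (uS); rewrite inS => /andP[u0 uO].
  by exists u => //; rewrite u0 inA // hdk.
move=> t u tO tA uO u0 uA.
have t0 : t != (0, 0).
  by apply: contraTneq tA => ->; rewrite inA ?zero_On // z0 ltxx.
have p2 := On_norm_gt0 tO t0.
have pt := On_dot_gt0 tO t0; have pu := On_dot_gt0 uO u0.
rewrite mulN1r oppr_lt0 -(pmulr_rgt0 _ p2) On_crs_slope subr_gt0.
move: tA uA; rewrite !inA // -leNgt !hd subr_gt0 subr_le0 => h1 h2.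
apply: (@lt_le_trans _ _ (dot p u * (c * dot p t))); first by rewrite ltr_pM2l.
by rewrite mulrCA mulrA mulrC ler_pM2l // mulrC.
Qed.

(* The cell of [A] lies strictly on one side of the parallel to [e] through [p]. *)
Definition hor (s : R) e A p :=
  closed_cell A p /\
  forall x, cell A x -> 0 < s * crs e (x.1 - p.1, x.2 - p.2).

(** Two such points lie on one parallel to [e]. No bisector is parallel to [e], so every power
    differs at [p] and [q], and their midpoint is in the open cell, although it lies on the parallel
    that the cell avoids. *)
Lemma hor_uniq (s : R) e A p q x : s != 0 -> (forall a, dot e a = 0 -> a = (0, 0)) ->
  cell A x -> hor s e A p -> hor s e A q -> p = q.
Proof.
move=> s0 he hx [pA hp] [qA hq].
have A0 := cell0 hx.
have lim (y y' : R * R) : closed_cell A y' ->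
    (forall z, cell A z -> 0 < s * crs e (z.1 - y.1, z.2 - y.2)) ->
    0 <= s * crs e (y'.1 - y.1, y'.2 - y.2).
  move=> y'A h; rewrite leNgt; apply/negP => hn.
  have h1 : cell A (along y' (x.1 - y'.1, x.2 - y'.2) 1).
    by apply: cell_mix => //; rewrite ltr01 lexx.
  set f0 := s * crs e (y'.1 - y.1, y'.2 - y.2) in hn.
  set f1 := s * crs e (x.1 - y.1, x.2 - y.2).
  have f1p : 0 < f1 by exact: h.
  (* Here the segment from [y'] to [x] crosses the parallel; the crossing point is in the open
     cell. *)
  pose w := - f0 / (f1 - f0).
  have den : 0 < f1 - f0 by rewrite subr_gt0 (lt_trans hn).
  have w01 : 0 < w <= 1.
    rewrite /w divr_gt0 ?oppr_gt0 //= ler_pdivrMr // mul1r.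
    by rewrite lerDr ltW.
  have := h _ (cell_mix hx y'A w01).
  have -> : s * crs e ((along y' (x.1 - y'.1, x.2 - y'.2) w).1 - y.1,
                       (along y' (x.1 - y'.1, x.2 - y'.2) w).2 - y.2) =
     f0 + w * (f1 - f0) by rewrite /f0 /f1 /crs /along /=; ring.
  by rewrite /w mulfVK ?gt_eqF // subrr ltxx.
have h1 := lim p q qA hp; have h2 := lim q p pA hq.
pose d : R * R := (q.1 - p.1, q.2 - p.2).
have c0 : crs e d = 0.
  apply: (mulfI s0); rewrite mulr0; apply/eqP; rewrite eq_le h1 andbT.
  by rewrite -oppr_ge0; move: h2; congr (0 <= _); rewrite /crs /=; ring.
apply: contrapT => pq.
have e2 : 0 < e.1 ^+ 2 + e.2 ^+ 2.
  rewrite lt0r addr_ge0 ?sqr_ge0 // andbT.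
  apply/eqP => /eqP; rewrite paddr_eq0 ?sqr_ge0 // !sqrf_eq0 => /andP[/eqP e1 /eqP e2].
  by have := he (1, 0); rewrite /dot e1 e2 !mul0r addr0 => /(_ erefl).
have dn a : dot d a = 0 -> a = (0, 0).
  move=> da; apply: he; apply: contrapT => /eqP ea; apply: pq.
  have d1 : d.1 * dot e a = 0.
    transitivity (e.1 * dot d a - a.2%:~R * crs e d); first by rewrite /dot /crs; ring.
    by rewrite da c0 !mulr0 subrr.
  have d2 : d.2 * dot e a = 0.
    transitivity (e.2 * dot d a + a.1%:~R * crs e d); first by rewrite /dot /crs; ring.
    by rewrite da c0 !mulr0 addr0.
  move/eqP: d1; move/eqP: d2; rewrite !mulf_eq0 (negPf ea) !orbF !subr_eq0 /=.
  by move=> /eqP h1' /eqP h2'; case: p q h1' h2' {pA qA hp hq h1 h2 d c0 da}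
    => p1 p2 [q1 q2] /= -> ->.
have hm : cell A (along p d (1 / 2)).
  apply/cellP; split=> // a a0.
  have -> : pow (along p d (1 / 2)) a = (pow p a + pow q a) / 2.
    by rewrite /pow /dot /along /d /=; field.
  have hdd : pow q a - pow p a = 2 * dot d a by rewrite /pow /dot /d /=; ring.
  have dna : dot d a != 0 by apply: contra_neq a0 => /dn.
  have [p1 p2] := pA a; have [q1 q2] := qA a.
  case: (boolP (a \in A)) => [aA|aA].
    have := p1 aA; have := q1 aA; move: dna hdd; rewrite neq_lt => /orP[]; lra.
  have := p2 aA; have := q2 aA; move: dna hdd; rewrite neq_lt => /orP[]; lra.
have := hp _ hm; rewrite (_ : crs e _ = 1 / 2 * crs e d).
  by rewrite c0 !mulr0 ltxx.
by rewrite /crs /along /=; ring.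
Qed.

(** Leaving [p] in direction [s e] makes exactly these circle points inner, so the cell entered is
    [In p] together with them. *)
Definition onside (s : R) e p := [fset a in On p | 0 < s * dot e a].

(** If the open cell meets the parallel to [e] through [p], then it does so at [p + c e] with
    [c != 0], and the sign of [c] makes [A] one of the two excluded sets. If it does not, convexity
    keeps it on one side. *)
Lemma hor_exists e A p x : (forall a, dot e a = 0 -> a = (0, 0)) ->
  cell A x -> closed_cell A p -> (1 < #|` On p|)%N ->
  A != In p `|` onside 1 e p -> A != In p `|` onside (-1) e p ->
  hor 1 e A p \/ hor (-1) e A p.
Proof.
move=> he hx pA cO A1 A2.
pose f y := crs e (y.1 - p.1, y.2 - p.2).
have e2 : 0 < e.1 ^+ 2 + e.2 ^+ 2.
  rewrite lt0r addr_ge0 ?sqr_ge0 // andbT.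
  apply/eqP => /eqP; rewrite paddr_eq0 ?sqr_ge0 // !sqrf_eq0 => /andP[/eqP e1 /eqP e2].
  by have := he (1, 0); rewrite /dot e1 e2 !mul0r addr0 => /(_ erefl).
have f0 y : cell A y -> f y != 0.
  move=> [yI yO]; apply/eqP => fy.
  pose c := ((y.1 - p.1) * e.1 + (y.2 - p.2) * e.2) / (e.1 ^+ 2 + e.2 ^+ 2).
  have hy a : pow y a = pow p a + 2 * c * dot e a.
    have hc : dot (y.1 - p.1, y.2 - p.2) a = c * dot e a.
      apply: (mulIf (lt0r_neq0 e2)); rewrite mulrAC /c mulfVK ?gt_eqF //.
      transitivity (((y.1 - p.1) * e.1 + (y.2 - p.2) * e.2) * dot e a +
        f y * crs e (emb R a)); first by rewrite /f /crs /dot /emb /=; ring.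
      by rewrite fy mul0r addr0.
    by rewrite -mulrA -hc /pow /dot /=; ring.
  have /closed_cellE[/fsubsetP h1 /fsubsetP h2] := pA.
  have side_eq (s : R) : 0 < s * c -> A = In p `|` onside s e p.
    move=> sc; apply/fsetP => a; rewrite in_fsetU in_sep.
    apply/idP/idP => [aA|/orP[/h1//|/andP[aO ha]]].
      have := h2 a aA; rewrite in_fsetU => /orP[->//|aO]; rewrite aO /=.
      move: aA aO; rewrite -yI in_In in_On hy => + /eqP pa; rewrite pa add0r => h.
      apply/orP; right; rewrite -(pmulr_rgt0 _ sc).
      have -> : s * c * (s * dot e a) = s ^+ 2 * (c * dot e a) by ring.
      rewrite pmulr_rgt0; first by move: h; rewrite -mulrA pmulr_rgt0.
      by rewrite exprn_even_gt0 //=; apply: contraTneq sc => ->; rewrite mul0r ltxx.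
    rewrite -yI in_In hy; move: aO; rewrite in_On => /eqP ->; rewrite add0r -mulrA.
    have c0 : c != 0 by apply: contraTneq sc => ->; rewrite mulr0 ltxx.
    rewrite pmulr_rgt0 // -(pmulr_rgt0 _ (_ : 0 < s ^+ 2)).
      have -> : s ^+ 2 * (c * dot e a) = s * c * (s * dot e a) by ring.
      by rewrite mulr_gt0.
    by rewrite exprn_even_gt0 //=; apply: contraTneq sc => ->; rewrite mul0r ltxx.
  have [c0|c0|c0] := ltgtP c 0.
  - by move/eqP: A2; apply; apply: side_eq; rewrite mulN1r oppr_gt0.
  - by move/eqP: A1; apply; apply: side_eq; rewrite mul1r.
  move: cO; suff -> : On p = On y by rewrite yO cardfs1.
  by apply/fsetP => a; rewrite !in_On hy c0 mulr0 mul0r addr0.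
have key y y' : cell A y -> cell A y' -> 0 < f y -> f y' < 0 -> False.
  move=> hy hy' fy fy'; pose w := f y / (f y - f y').
  have den : 0 < f y - f y' by rewrite subr_gt0 (lt_trans fy').
  have w01 : 0 < w <= 1.
    by rewrite /w divr_gt0 //= ler_pdivrMr // mul1r lerDl oppr_ge0 ltW.
  have /f0/eqP := cell_mix hy' (cell_closed hy) w01; apply.
  transitivity (f y - w * (f y - f y')); first by rewrite /f /crs /along /=; ring.
  by rewrite /w mulfVK ?gt_eqF // subrr.
have [fx|fx|fx] := ltgtP (f x) 0; last by have := f0 x hx; rewrite fx eqxx.
  right; split=> // y hy; rewrite mulN1r oppr_gt0 -/(f y).
  by have [|fy|fy] := ltgtP (f y) 0 => //; [case: (key y x)|have := f0 y hy; rewrite fy eqxx].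
left; split=> // y hy; rewrite mul1r -/(f y).
by have [fy||fy] := ltgtP (f y) 0 => //; [case: (key x y)|have := f0 y hy; rewrite fy eqxx].
Qed.

End Vertices.

(** * Counting cells by vertices *)

Section Counting.
Variable R : realType.
Implicit Types (x y p q d e : R * R) (a b t u : int * int) (A B : {fset int * int}).

Lemma leq_size_rel (T U : eqType) (s : seq T) (s' : seq U) (r : T -> U -> Prop) :
  uniq s -> (forall z, z \in s -> exists2 w, w \in s' & r z w) ->
  (forall z z' w, z \in s -> z' \in s -> w \in s' -> r z w -> r z' w -> z = z') ->
  (size s <= size s')%N.
Proof.
case: s => [//|z0 s] us hex hinj.
have [w0 _ _] := hex z0 (mem_head _ _).
have /choice[f hf] : forall z, exists w, z \in z0 :: s -> w \in s' /\ r z w.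
  move=> z; have [zs|_] := boolP (z \in z0 :: s); last by exists w0.
  by have [w ws rw] := hex z zs; exists w.
rewrite -(size_map f); apply: uniq_leq_size.
  rewrite map_inj_in_uniq // => z z' zs zs' e.
  have [h1 h2] := hf z zs; have [h3 h4] := hf z' zs'.
  by apply: (hinj z z' (f z)) => //; rewrite e.
by move=> _ /mapP[z zs ->]; have [] := hf z zs.
Qed.

Lemma norm_box x (M : nat) a : x.1 ^+ 2 + x.2 ^+ 2 <= 2 * M%:R ^+ 2 ->
  0 <= pow x a -> a \in box (4 * M).
Proof.
move=> h; apply: pow_ge0_box; rewrite natrM (_ : 4 = 2 * 2); last by ring.
rewrite -mulrA ler_pM2l // -ler_sqr ?nnegrE ?mulr_ge0 ?addr_ge0 //.
rewrite -[x.1 ^+ 2]real_normK ?num_real // -[x.2 ^+ 2]real_normK ?num_real // in h.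
move: h; move: `|x.1| `|x.2| M%:R => u v w h; have := sqr_ge0 (u - v); nra.
Qed.

Definition cells (l : nat) : {fset {fset int * int}} :=
  [fset A in fpowerset (box (4 * l.+1)) |
     `[< exists x : R * R, cell A x >] && (#|` A| == l)].

Lemma in_cells l A : reflect ((exists x : R * R, cell A x) /\ #|` A| = l) (A \in cells l).
Proof.
rewrite in_sep; apply: (iffP and3P) => [[_ /asboolP h /eqP //]|[[x hx] Al]].
split; [|by apply/asboolP; exists x|by apply/eqP].
rewrite fpowersetE; apply/fsubsetP => a; have [<- _] := hx; rewrite in_In => /ltW.
by apply: norm_box; rewrite -Al; apply: closed_cell_bound; exact: cell_closed.
Qed.

Definition circumcenter a b : R * R :=
  let D := 2 * crs (emb R a) (emb R b) in
  (((gnorm a)%:~R * b.2%:~R - (gnorm b)%:~R * a.2%:~R) / D,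
   ((gnorm b)%:~R * a.1%:~R - (gnorm a)%:~R * b.1%:~R) / D).

Lemma On_circumcenter p a b : a \in On p -> b \in On p ->
  a != (0, 0) -> b != (0, 0) -> a != b -> p = circumcenter a b.
Proof.
move=> aO bO a0 b0 ab.
have D0 : crs (emb R a) (emb R b) != 0.
  by apply: contra_not_neq (elimN eqP ab); exact: (On_crs aO bO).
rewrite /circumcenter -(On_dot aO) -(On_dot bO); case: p {aO bO} => p1 p2.
move: D0; rewrite /crs /dot /emb /= => D0; congr pair; field; exact: D0.
Qed.

Lemma three_points (T : choiceType) (S : {fset T}) z : (2 < #|` S|)%N -> z \in S ->
  exists v w, [/\ v \in S, w \in S, v != z, w != z & v != w].
Proof.
move=> h zS; rewrite (cardfsD1 z) zS add1n ltnS in h.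
have /fset0Pn[a aS] : S `\ z != fset0 by rewrite -cardfs_gt0 ltnW.
rewrite (cardfsD1 a) aS add1n ltnS in h.
have /fset0Pn[b] : S `\ z `\ a != fset0 by rewrite -cardfs_gt0.
rewrite !in_fsetD1 => /and3P[ba bz bS]; move: aS; rewrite in_fsetD1 => /andP[az aS].
by exists a, b; rewrite az bz aS bS eq_sym ba.
Qed.

(** The origin belongs to [On p], so the bound 2 asks for two bisectors through [p]. *)
Definition vertices (K : nat) : {fset R * R} :=
  let B := box (4 * K.+1) in
  [fset p in seq_fset tt [seq circumcenter a b | a <- B, b <- B] |
     (2 < #|` On p|)%N && (#|` In p| <= K)%N].

Lemma in_vertices K p :
  (p \in vertices K) = (2 < #|` On p|)%N && (#|` In p| <= K)%N.
Proof.
rewrite in_sep andb_idl // => /andP[h2 hK].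
have [a [b [aO bO a0 b0 ab]]] := three_points h2 (zero_On p).
rewrite seq_fsetE (On_circumcenter aO bO a0 b0 ab).
have hb c : c \in On p -> c \in box (4 * K.+1).
  rewrite in_On => /eqP pc; apply: (@norm_box p); last by rewrite pc.
  by apply: norm_bound; apply: leq_ltn_trans hK _; rewrite -mulnn; lia.
by apply: allpairs_f; apply: hb.
Qed.

Lemma card_InU p (S : {fset int * int}) : S `<=` On p ->
  #|` In p `|` S| = (#|` In p| + #|` S|)%N.
Proof.
move=> /fsubsetP hS; rewrite cardfsU (_ : _ `&` _ = fset0) ?cardfs0 ?subn0 //.
apply/fsetP => a; rewrite in_fsetI in_fset0 in_In; apply/negbTE/negP => /andP[pa].
by move/hS; rewrite in_On gt_eqF.
Qed.

Lemma side_card (s : R) A p : (0, 0) \notin A -> side s A p ->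
  (#|` In p| < #|` A|)%N /\ (#|` A|.+1 < #|` In p| + #|` On p|)%N.
Proof.
move=> A0 [/closed_cellE[h1 h2] [t tO tA] [u uO /andP[u0 uA]] _].
split.
  apply: fproper_ltn_card; rewrite fproperE h1 /=; apply/fsubsetPn.
  by exists t => //; rewrite in_In; move: tO; rewrite in_On => /eqP ->; rewrite ltxx.
rewrite -(card_InU (fsubset_refl (On p))).
have -> : #|` A|.+2 = #|` (0, 0) |` (u |` A)|.
  by rewrite !cardfsU1 uA !in_fsetU in_fset1 eq_sym (negPf u0) (negPf A0).
apply: fsubset_leq_card; apply/fsubsetP => a; rewrite !in_fsetU !in_fset1.
case/or3P => [/eqP->|/eqP->|]; rewrite ?zero_On ?uO ?orbT //.
by move/(fsubsetP h2); rewrite in_fsetU.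
Qed.

(** With [l = k - 1], [j] inner points and [m + 1] circle points, this is the condition
    [j < k - 1 < j + m]. *)
Definition zone_vertices (l : nat) : {fset R * R} :=
  [fset p in vertices l | (#|` In p| < l)%N && (l.+1 < #|` In p| + #|` On p|)%N].

Lemma in_zone_vertices l p : (p \in zone_vertices l) =
  (#|` In p| < l)%N && (l.+1 < #|` In p| + #|` On p|)%N.
Proof.
rewrite in_sep in_vertices andb_idl // => /andP[h1 h2]; apply/andP; split; last exact: ltnW.
by move: h1 h2; move: #|` In p| #|` On p| => m n; lia.
Qed.

(* A cell other than that of the origin has a unique last vertex in the angular
   order, and a vertex is the last one of at most one cell of a given level. *)
Lemma card_cells l : (0 < l)%N -> #|` cells l| = #|` zone_vertices l|.
Proof.
have s0 : -1 != 0 :> R by rewrite oppr_eq0 oner_eq0.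
move=> l0; apply/eqP; rewrite eqn_leq; apply/andP; split.
  apply: (@leq_size_rel _ _ _ _ (fun A p => side (-1) A p)); first exact: fset_uniq.
    move=> A /in_cells[[x hx] Al].
    have An : A != fset0 by rewrite -cardfs_gt0 Al.
    have [p hp] := side_exists s0 hx An.
    exists p => //; rewrite in_zone_vertices.
    by have [] := side_card (cell0 hx) hp; rewrite Al => -> ->.
  move=> A B p /in_cells[[x hx] Al] /in_cells[[y hy] Bl] _ hA hB.
  by apply: side_inj hA hB; [exact: cell0 hx|exact: cell0 hy|rewrite Al Bl].
apply: (@leq_size_rel _ _ _ _ (fun p A => side (-1) A p)); first exact: fset_uniq.
  move=> p; rewrite in_zone_vertices => /andP[h1 h2].
  have [A [x [hx Al hA]]] := side_realize h1 h2.
  by exists A => //; apply/in_cells; split=> //; exists x.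
move=> p q A _ _ /in_cells[[x hx] _]; apply: side_uniq; last exact: cell0 hx.
by rewrite oppr_eq0 oner_eq0.
Qed.

End Counting.

(** * Double counting of incidences between vertices and cells *)

Section Balance.
Variables (R : realType) (e : R * R).
Hypothesis e_gen : forall a, dot e a = 0 -> a = (0, 0).
Implicit Types (x y p q d : R * R) (a b t u : int * int) (A B : {fset int * int}).

Definition closed_cellb A p := (In p `<=` A) && (A `<=` In p `|` On p).

Lemma closed_cellP A p : reflect (closed_cell A p) (closed_cellb A p).
Proof. by apply: (iffP andP) => /closed_cellE. Qed.

Lemma onside_sub (s : R) p : onside s e p `<=` On p.
Proof. by apply/fsubsetP => a; rewrite in_sep => /andP[]. Qed.

Lemma card_cells0 : (#|` cells R 0| <= 1)%N.
Proof.
rewrite -(cardfs1 (fset0 : {fset int * int})); apply: fsubset_leq_card.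
apply/fsubsetP => A /in_cells[_ /eqP]; rewrite cardfs_eq0 in_fset1.
by [].
Qed.

Lemma count_split3 (T : eqType) (s : seq T) (a b : pred T) :
  (size s <= count a s + count b s + count (fun z => ~~ (a z || b z)) s)%N.
Proof.
elim: s => //= z s IH; move: IH; case: (a z); case: (b z) => /=; lia.
Qed.

Lemma count_split3_disj (T : eqType) (s : seq T) (a b : pred T) :
  (forall z, z \in s -> a z -> ~~ b z) ->
  (count a s + count b s + count (fun z => ~~ (a z || b z)) s <= size s)%N.
Proof.
elim: s => //= z s IH h.
have {}IH := IH (fun w ws => h w (mem_behead (s := z :: s) ws)).
have := h z (mem_head _ _); move: IH; case: (a z); case: (b z) => /=; lia.
Qed.

(* The incidences between vertices and cells of level [l] are counted twice.
   Seen from the origin every cell of level [l > 0] is extremal at exactly two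
   vertices, and an incident cell fails to be extremal at [p] only if it lies
   on the near or on the far side of all bisectors through [p].  Along the
   pencil of parallels to [e] every cell is extremal at no more than two
   vertices, and the non-extremal incidences come from the two cells that meet
   the line through [p]. *)
Lemma level_balance (K l : nat) : (l <= K)%N ->
  (count (fun p => #|` In p| == l) (vertices R K) +
   count (fun p => (#|` In p| + #|` On p|).-1 == l) (vertices R K) <=
   count (fun p => #|` In p| + #|` onside 1 e p| == l) (vertices R K) +
   count (fun p => #|` In p| + #|` onside (-1) e p| == l) (vertices R K) +
   2 * (l == 0))%N.
Proof.
move=> lK.
pose V := vertices R K; pose C := cells R l.
have uV : uniq V := fset_uniq _; have uC : uniq C := fset_uniq _.
pose Inc := [seq pA <- [seq (p, A) | p <- V, A <- C] | closed_cellb pA.2 pA.1].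
have uInc : uniq Inc by rewrite filter_uniq // allpairs_uniq // => -[? ?] [? ?].
have inInc p A : ((p, A) \in Inc) = [&& closed_cellb A p, p \in V & A \in C].
  rewrite mem_filter /=; congr (_ && _); apply/allpairsP/andP.
    by case=> -[p' A'] /= [h1 h2 [-> ->]].
  by case=> h1 h2; exists (p, A).
pose near (z : (R * R) * {fset int * int}) := z.2 == In z.1.
pose far (z : (R * R) * {fset int * int}) := z.2 == (In z.1 `|` On z.1) `\ (0, 0).
pose up (s : R) (z : (R * R) * {fset int * int}) := z.2 == In z.1 `|` onside s e z.1.
pose sgn (b : bool) : R := if b then 1 else -1.
have sgn0 (b : bool) : sgn b != 0 by case: b; rewrite /sgn ?oppr_eq0 oner_eq0.
pose CC := [seq (A, c) | A <- C, c <- [:: true; false]].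
have uCC : uniq CC by rewrite allpairs_uniq // => -[? ?] [? ?].
have sCC : size CC = (2 * #|` C|)%N by rewrite size_allpairs mulnC.
have inCC A (b : bool) : ((A, b) \in CC) = (A \in C).
  apply/allpairsP/idP => [[[A' b'] /= [h _ [-> _]]] //|h].
  by exists (A, b); split=> //=; case: b.
have inV p : p \in V -> [/\ (2 < #|` On p|)%N & (#|` In p| <= K)%N].
  by rewrite in_vertices => /andP[].
have cW p : #|` (In p `|` On p) `\ (0, 0)| = (#|` In p| + #|` On p|).-1.
  have := cardfsD1 (0, 0) (In p `|` On p).
  by rewrite in_fsetU zero_On orbT card_InU ?fsubset_refl // => ->.
have ex_cell p d : (forall a, a \in On p -> dot d a = 0 -> a = (0, 0)) ->
    exists x, cell (In p `|` [fset a in On p | 0 < dot d a]) x.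
  move=> hd; have [s s0 hs] := In_On_along p d.
  have /hs[hI hO] : 0 < s <= s by rewrite s0 lexx.
  exists (along p d s); split=> //; rewrite hO; apply/fsetP => a.
  rewrite in_sep in_fset1; apply/andP/eqP => [[aO /eqP /(hd a aO)] //|->].
  by rewrite zero_On /dot /= !mulr0 addr0 eqxx.
have nearC p : exists x, cell (In p) x.
  have [|x hx] := ex_cell p (- p.1, - p.2).
    move=> a aO h; apply/eqP; apply: contraTT isT => a0.
    have := On_dot_gt0 aO a0; suff -> : dot p a = 0 by rewrite ltxx.
    by move: h; rewrite /dot /= !mulNr -opprD => /eqP; rewrite oppr_eq0 => /eqP.
  exists x; move: hx; rewrite (_ : [fset _ in _ | _] = fset0) ?fsetU0 //.
  apply/fsetP => a; rewrite in_sep in_fset0; apply/negbTE/negP => /andP[/On_dot h].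
  rewrite (_ : dot _ a = - dot p a); last by rewrite /dot /=; ring.
  rewrite oppr_gt0 => h'; have : (0 : R) <= (gnorm a)%:~R by rewrite ler0z gnorm_ge0.
  by rewrite -h pmulr_rge0 // leNgt h'.
have farC p : exists x, cell ((In p `|` On p) `\ (0, 0)) x.
  have [|x hx] := ex_cell p p.
    move=> a aO h; apply/eqP; apply: contraTT isT => a0.
    by have := On_dot_gt0 aO a0; rewrite h ltxx.
  exists x; move: hx; congr cell; apply/fsetP => a.
  rewrite in_fsetD1 !in_fsetU in_sep.
  have [->|a0] := eqVneq a (0, 0).
    by rewrite zero_In zero_On /dot /= !mulr0 addr0 ltxx.
  by case: (boolP (a \in On p)) => aO //=; rewrite (On_dot_gt0 aO a0).
have nearLe : (count (fun p => #|` In p| == l) V <= count near Inc)%N.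
  rewrite -!size_filter.
  apply: (@leq_size_rel _ _ _ _ (fun p z => z.1 = p)); first exact: filter_uniq.
    move=> p; rewrite mem_filter => /andP[/eqP hl pV].
    exists (p, In p) => //; rewrite mem_filter /near /= eqxx inInc pV /=.
    rewrite /closed_cellb fsubset_refl fsubsetUl /=.
    by apply/in_cells; split; [exact: nearC|].
  by move=> p q z _ _ _ <-.
have farLe : (count (fun p => (#|` In p| + #|` On p|).-1 == l) V <= count far Inc)%N.
  rewrite -!size_filter.
  apply: (@leq_size_rel _ _ _ _ (fun p z => z.1 = p)); first exact: filter_uniq.
    move=> p; rewrite mem_filter => /andP[/eqP hl pV].
    exists (p, (In p `|` On p) `\ (0, 0)) => //; rewrite mem_filter /far /= eqxx inInc pV /=.
    rewrite /closed_cellb fsubD1set andbT.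
    apply/andP; split.
      apply/fsubsetP => a ha; rewrite in_fsetD1 in_fsetU ha andbT.
      by apply: contraTneq ha => ->; rewrite zero_In.
    by apply/in_cells; split; [exact: farC|rewrite cW].
  by move=> p q z _ _ _ <-.
have upLe s : (count (up s) Inc <=
    count (fun p => #|` In p| + #|` onside s e p| == l)%N V)%N.
  rewrite -!size_filter.
  apply: (@leq_size_rel _ _ _ _ (fun z p => z.1 = p)); first exact: filter_uniq.
    move=> [p A]; rewrite mem_filter inInc => /and4P[/eqP /= -> _ pV /in_cells[_ hA]].
    by exists p => //; rewrite mem_filter pV -hA card_InU ?onside_sub // eqxx.
  move=> [p A] [q B] r; rewrite !mem_filter => /andP[/eqP /= -> _] /andP[/eqP /= -> _].
  by move=> _ -> ->.
have horLe : (count (fun z => ~~ (up 1%R z || up (-1)%R z)) Inc <= 2 * #|` C|)%N.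
  rewrite -size_filter -sCC.
  apply: (@leq_size_rel _ _ _ _ (fun z w => z.2 = w.1 /\ hor (sgn w.2) e z.2 z.1)).
  - exact: filter_uniq.
  - move=> [p A]; rewrite mem_filter inInc /= negb_or.
    move=> /and4P[/andP[h1 h2] /closed_cellP pA /inV[cO _] AC].
    have /in_cells[[x hx] _] := AC.
    have [h|h] := hor_exists e_gen hx pA (ltnW cO) h1 h2.
      by exists (A, true); rewrite ?inCC.
    by exists (A, false); rewrite ?inCC.
  move=> [p A] [q B] [D b]; rewrite inCC /= => _ _ /in_cells[[x hx] _].
  move=> [-> h1] [-> h2]; congr pair.
  by apply: (hor_uniq (sgn0 b) e_gen hx h1 h2).
have sideGe : (0 < l)%N -> (2 * #|` C| <= count (fun z => ~~ (near z || far z)) Inc)%N.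
  move=> l0; rewrite -size_filter -sCC.
  apply: (@leq_size_rel _ _ _ _ (fun w z => z.2 = w.1 /\ side (sgn w.2) z.2 z.1)) => //.
    move=> [A b]; rewrite inCC => AC; have /in_cells[[x hx] Al] := AC.
    have An : A != fset0 by rewrite -cardfs_gt0 Al.
    have [p hp] := side_exists (sgn0 b) hx An.
    have [c1 c2] := side_card (cell0 hx) hp.
    exists (p, A) => //; rewrite mem_filter inInc AC /= negb_or /near /far /=.
    have [/closed_cellP -> _ _ _] := hp; rewrite in_vertices /= andbT.
    rewrite (leq_trans (ltnW c1)) ?Al // andbT -andbA; apply/and3P; split.
    - by apply: contraTneq c1 => ->; rewrite ltnn.
    - by apply: contraTneq c2 => ->; rewrite cW; move: (_ + _)%N => [|n] //=; rewrite ltnn.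
    - by move: c1 c2; move: #|` In p| #|` On p| #|` A| => m n r; lia.
  move=> [A b] [B b'] [p D] _ _ _ /= [eA h1] [eB h2]; rewrite -eA -eB; congr pair.
  case: b b' h1 h2 => -[] //= h1 h2; first by case: (side_opp h1 h2).
  by case: (side_opp h2 h1).
have nf z : z \in Inc -> near z -> ~~ far z.
  case: z => p A; rewrite inInc /near /far /= => /and3P[_ /inV[cO _] _] /eqP ->.
  apply/eqP => /(congr1 (fun S : {fset int * int} => #|` S|)); rewrite cW.
  by move: cO; move: #|` In p| #|` On p| => m n; lia.
have lo := count_split3_disj nf.
have hi := count_split3 Inc (up 1) (up (-1)).
have arith (b1 b2 c1 c2 n f u1 u2 X Y s F i : nat) : (b1 <= n -> b2 <= f ->
    u1 <= c1 -> u2 <= c2 -> n + f + X <= s -> s <= u1 + u2 + Y -> Y <= 2 * F ->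
    2 * F <= X + i -> b1 + b2 <= c1 + c2 + i)%N by lia.
apply: (arith _ _ _ _ _ _ _ _ _ _ _ _ _ nearLe farLe (upLe 1) (upLe (-1)) lo hi horLe).
(* At level 0 there is at most one cell, and the summand 2 pays for its two extremal vertices in the
   parallel sweep. *)
have [l0|l0] := posnP l; last by rewrite muln0 addn0; exact: sideGe.
apply: leq_trans (leq_addl _ _); rewrite leq_mul2l /C l0; exact: card_cells0.
Qed.

End Balance.

(** * The upper bound *)

Section UpperBound.
Variable R : realType.
Implicit Types (x y p q d e : R * R) (a b t u v w : int * int) (A B : {fset int * int}).

(** The irrational slope ensures that no bisector is parallel to this direction and that distinct
    lattice points have distinct heights along it. *)
Definition irr_dir : R * R := (1, Num.sqrt 2).

Lemma irr_dir_gen a : dot irr_dir a = 0 -> a = (0, 0).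
Proof.
case: a => a b; rewrite /dot /= mul1r => h.
have e : a ^+ 2 = 2 * b ^+ 2.
  have /(congr1 (fun r => r ^+ 2)) : a%:~R = - (Num.sqrt 2 * b%:~R) :> R.
    by apply/eqP; rewrite -addr_eq0 h.
  rewrite sqrrN exprMn sqr_sqrtr ?ler0n // -!rmorphXn /=.
  by rewrite (_ : 2 = 2%:~R :> R) // -intrM => /intr_inj.
have en : (absz a ^ 2 = 2 * absz b ^ 2)%N by rewrite -!abszX e abszM.
have [b0|b0] := posnP (absz b).
  rewrite b0 in en; move/eqP: en; rewrite muln0 expn_eq0 absz_eq0 andbT => /eqP ->.
  by move/eqP: b0; rewrite absz_eq0 => /eqP ->.
have /(congr1 (logn 2)) := en; rewrite lognM ?expn_gt0 ?b0 // !lognX.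
by move=> /(congr1 odd); rewrite oddM /= oddD oddM.
Qed.

Local Notation e := irr_dir.

Lemma dot_sub (d : R * R) a b : dot d a = dot d b -> dot d (a.1 - b.1, a.2 - b.2) = 0.
Proof. by move=> h; transitivity (dot d a - dot d b); [rewrite /dot /=; ring|rewrite h subrr]. Qed.

Lemma dot_irr_inj : injective (dot e).
Proof.
move=> [a1 a2] [b1 b2] /dot_sub/irr_dir_gen [] /= h1 h2.
by congr pair; apply/eqP; rewrite -subr_eq0 ?h1 ?h2.
Qed.

Definition trans p v : R * R := (p.1 - v.1%:~R, p.2 - v.2%:~R).
Definition zadd a b : int * int := (a.1 + b.1, a.2 + b.2).
Definition zopp a : int * int := (- a.1, - a.2).

Lemma zadd_inj v : injective (zadd^~ v).
Proof. by move=> [a1 a2] [b1 b2] [] /addIr -> /addIr ->. Qed.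



Lemma zaddNK v : cancel (zadd^~ (zopp v)) (zadd^~ v).
Proof. by move=> [a b]; rewrite /zadd /= !subrK. Qed.

Lemma transK p v : trans (trans p v) (zopp v) = p.
Proof. by case: p => p1 p2; rewrite /trans /= !rmorphN /= !opprK !subrK. Qed.

Lemma In_trans p v a : v \in On p -> (a \in In (trans p v)) = (zadd a v \in In p).
Proof. by move=> vO; rewrite !in_In pow_shift. Qed.

Lemma On_trans p v a : v \in On p -> (a \in On (trans p v)) = (zadd a v \in On p).
Proof. by move=> vO; rewrite !in_On pow_shift. Qed.

Lemma zopp_On p v : v \in On p -> zopp v \in On (trans p v).
Proof. by move=> vO; rewrite On_trans // /zadd /= !addNr zero_On. Qed.

Lemma card_trans p v : v \in On p ->
  #|` In (trans p v)| = #|` In p| /\ #|` On (trans p v)| = #|` On p|.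
Proof.
have le q w : w \in On q -> (#|` In (trans q w)| <= #|` In q|)%N /\
    (#|` On (trans q w)| <= #|` On q|)%N.
  move=> wO; split.
    apply: (@leq_size_rel _ _ _ _ (fun a b => b = zadd a w)); first exact: fset_uniq.
      by move=> a; rewrite In_trans // => ha; exists (zadd a w).
    by move=> a b c _ _ _ -> /zadd_inj.
  apply: (@leq_size_rel _ _ _ _ (fun a b => b = zadd a w)); first exact: fset_uniq.
    by move=> a; rewrite On_trans // => ha; exists (zadd a w).
  by move=> a b c _ _ _ -> /zadd_inj.
move=> vO; have [h1 h2] := le _ _ vO; have [h3 h4] := le _ _ (zopp_On vO).
by rewrite transK in h3 h4; split; apply/eqP; rewrite eqn_leq ?h1 ?h2 ?h3 ?h4.
Qed.

(** Once [v] is moved to the origin, this is the number of circle points on the side of [e]. Heights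
    are distinct, so it takes each value below the number of circle points once. *)
Definition rank p v := count (fun b => dot e v < dot e b) (On p).

Lemma rank_lt p v : v \in On p -> (rank p v < #|` On p|)%N.
Proof.
move=> vO; rewrite ltn_neqAle count_size andbT -all_count.
by apply/allPn; exists v; rewrite ?ltxx.
Qed.

Lemma rank_compl p v : v \in On p ->
  count (fun b => dot e b < dot e v) (On p) = (#|` On p|.-1 - rank p v)%N.
Proof.
move=> vO; have h := rank_lt vO.
have : (#|` On p| = rank p v + count (fun b => dot e b < dot e v)%R (On p) + 1)%N.
  have -> : 1%N = count (pred1 v) (On p) by rewrite count_uniq_mem ?vO ?fset_uniq.
  rewrite /rank; elim: (On p : seq _) => //= b s ->.
  have [h1|h1|h1] := ltgtP (dot e b) (dot e v).
  - by rewrite (_ : b == v = false) ?addn0; [lia|apply: contraTF h1 => /eqP ->; rewrite ltxx].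
  - by rewrite (_ : b == v = false) ?addn0; [lia|apply: contraTF h1 => /eqP ->; rewrite ltxx].
  - by rewrite (dot_irr_inj h1) eqxx; lia.
by move: h; move: (rank _ _) (count _ _) #|` On p| => r c n; lia.
Qed.

Lemma rank_inj p : {in On p &, injective (rank p)}.
Proof.
have lt v w : v \in On p -> w \in On p -> dot e v < dot e w -> (rank p w < rank p v)%N.
  move=> vO wO vw; rewrite /rank -!card_sep; apply: fproper_ltn_card.
  rewrite fproperE; apply/andP; split.
    apply/fsubsetP => b; rewrite !in_sep => /andP[-> /=]; exact: lt_trans.
  by apply/fsubsetPn; exists w; rewrite !in_sep wO ?ltxx.
move=> v w vO wO h; apply: dot_irr_inj; have [h1|h1|//] := ltgtP (dot e v) (dot e w).
  by have := lt v w vO wO h1; rewrite h ltnn.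
by have := lt w v wO vO h1; rewrite h ltnn.
Qed.

Lemma rank_perm p : perm_eq [seq rank p v | v <- On p] (iota 0 #|` On p|).
Proof.
have u : uniq [seq rank p v | v <- On p].
  by rewrite map_inj_in_uniq ?fset_uniq //; exact: rank_inj.
apply: uniq_perm; rewrite ?iota_uniq //.
have [] := uniq_min_size u (s2 := iota 0 #|` On p|) => //.
  by move=> _ /mapP[v vO ->]; rewrite mem_iota add0n /= rank_lt.
by rewrite size_map size_iota.
Qed.

Lemma sum_rank p (g : nat -> nat) :
  (\sum_(v <- On p) g (rank p v) = \sum_(0 <= i < #|` On p|) g i)%N.
Proof.
by rewrite -(big_map (rank p) xpredT) /index_iota subn0; apply: perm_big; exact: rank_perm.
Qed.

Lemma count_On_trans (P : pred R) p v : v \in On p ->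
  count (fun a => P (dot e a)) (On (trans p v)) =
  count (fun b => P (dot e b - dot e v)) (On p).
Proof.
move=> vO; have dz a b : dot e (zadd a b) = dot e a + dot e b by rewrite /dot /zadd /=; ring.
have -> : count (fun b => P (dot e b - dot e v)) (On p) =
    count (fun b => P (dot e b - dot e v)) [seq zadd a v | a <- On (trans p v)].
  apply/permP/uniq_perm; rewrite ?fset_uniq ?(map_inj_uniq (@zadd_inj v)) ?fset_uniq //.
  move=> b; apply/idP/mapP => [bO|[a aO ->]]; last by rewrite -On_trans.
  by exists (zadd b (zopp v)); rewrite ?(On_trans _ vO) zaddNK.
by rewrite count_map; apply: eq_count => a /=; rewrite dz addrK.
Qed.

Lemma card_onside_trans p v : v \in On p ->
  #|` onside 1 e (trans p v)| = rank p v /\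
  #|` onside (-1) e (trans p v)| = (#|` On p|.-1 - rank p v)%N.
Proof.
move=> vO; rewrite !card_sep -rank_compl //; split.
  rewrite (count_On_trans (fun r => 0 < 1 * r)) //.
  by apply: eq_count => b; rewrite mul1r subr_gt0.
rewrite (count_On_trans (fun r => 0 < -1 * r)) //.
by apply: eq_count => b; rewrite mulN1r oppr_gt0 subr_lt0.
Qed.

Lemma sum_count_level (T : eqType) (s : seq T) (f : T -> nat) (l : nat) :
  (\sum_(0 <= i < l) (l - i) * count (fun z => f z == i) s = \sum_(z <- s) (l - f z))%N.
Proof.
elim: s => [|z s IH]; first by rewrite big_nil big1 // => i _; rewrite muln0.
rewrite big_cons -IH; under eq_bigr do rewrite /= mulnDr.
rewrite big_split /=; congr addn.
have [zl|zl] := leqP l (f z).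
  rewrite (eqP zl) big_nat_cond big1 // => i /andP[/andP[_ il] _].
  by rewrite gtn_eqF ?muln0 // (leq_trans il).
rewrite (bigD1_seq (f z)) ?iota_uniq //=; last by rewrite mem_index_iota.
by rewrite eqxx muln1 big1 ?addn0 // => i /negPf; rewrite eq_sym => ->; rewrite muln0.
Qed.

(** Level [i] is weighted by [l - i], and truncated subtraction drops the levels from [l] on. The
    term [2 * l] is the defect of level 0 with its weight [l]. *)
Lemma balance_sum l : (0 < l)%N ->
  (\sum_(p <- vertices R l.-1) ((l - #|` In p|) + (l - (#|` In p| + #|` On p|).-1)) <= 2 * l +
   \sum_(p <- vertices R l.-1) ((l - (#|` In p| + #|` onside 1 e p|)) +
                  (l - (#|` In p| + #|` onside (-1) e p|))))%N.
Proof.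
move=> l0; rewrite !big_split /= -!sum_count_level -!big_split /=.
have -> : (2 * l = \sum_(0 <= i < l) (l - i) * (2 * (i == 0)))%N.
  rewrite big_ltn // subn0 eqxx muln1 mulnC big_nat_cond big1 ?addn0 // => i.
  by case: i => [|i]; rewrite ?ltnn //= !muln0.
rewrite addnC -big_split /= big_nat_cond [X in (_ <= X)%N]big_nat_cond.
apply: leq_sum => i /andP[/andP[_ il] _].
rewrite -!mulnDr leq_mul2l; apply/orP; right.
by apply: (level_balance irr_dir_gen); lia.
Qed.

(* The vertices [trans p v], for [v] in [On p], are the translates of one circle
   that carry [0]; they have the same numbers of inner and boundary points. *)
Lemma trans_sum (K : nat) (g : R * R -> nat) :
  \sum_(p <- vertices R K) (g p)%:R =
  \sum_(p <- vertices R K) (\sum_(v <- On p) g (trans p v))%N%:R / (#|` On p|)%:R :> rat.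
Proof.
set V := vertices R K; pose h (z : (R * R) * (int * int)) := (trans z.1 z.2, zopp z.2).
pose L := [seq (p, v) | p <- V, v <- On p : seq _].
have inL p v : ((p, v) \in L) = (p \in V) && (v \in On p).
  apply/allpairsPdep/andP => [[p' [v' [h1 h2 [-> ->]]]] //|[h1 h2]].
  by exists p, v.
have uL : uniq L.
  apply: allpairs_uniq_dep => [|p _|]; rewrite ?fset_uniq //.
  by move=> [p v] [q w] _ _ /= [-> ->].
have hL z : z \in L -> h z \in L.
  case: z => p v; rewrite !inL => /andP[pV vO]; rewrite zopp_On // andbT.
  by rewrite in_vertices; have [-> ->] := card_trans vO; rewrite -in_vertices.
have hh z : h (h z) = z.
  by case: z => p [v1 v2]; rewrite /h /= transK /zopp /= !opprK.
have pL : perm_eq L (map h L).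
  apply: uniq_perm => //; first by rewrite (map_inj_uniq (can_inj hh)).
  move=> z; apply/idP/mapP => [zL|[w wL ->]]; last exact: hL.
  by exists (h z); rewrite ?hL.
pose F (z : (R * R) * (int * int)) : rat := (g z.1)%:R / (#|` On z.1|)%:R.
transitivity (\sum_(z <- L) F z).
  rewrite big_allpairs_dep /=; apply: eq_big_seq => p; rewrite in_vertices => /andP[h2 _].
  rewrite /F /= big_const_seq count_predT iter_addr addr0 -[RHS]mulr_natr mulfVK //.
  by rewrite pnatr_eq0 -lt0n; apply: leq_trans h2.
rewrite (perm_big _ pL) big_map big_allpairs_dep /=; apply: eq_bigr => p _.
rewrite natr_sum mulr_suml; apply: eq_big_seq => v vO; rewrite /F /=.
by have [_ ->] := card_trans vO.
Qed.

Lemma sum_trunc (al s : nat) : (0 < al)%N ->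
  (2 * \sum_(0 <= i < s) (al - i) = minn s al * (2 * al - minn s al + 1))%N.
Proof.
move=> al0; elim: s => [|s IH]; first by rewrite big_nil min0n.
by rewrite big_nat_recr //= mulnDr IH; have [h|h] := leqP al s; nia.
Qed.

(** For [s <= al + 1] both sides agree, the weight being affine on the levels involved. Otherwise
    put [b = s - 1 - al >= 1]; the claim becomes [al + b + 1 <= 3 al b], where each summand on the
    left is at most [al b]. *)
Lemma average_gap (al s : nat) : (0 < al)%N -> (2 < s)%N ->
  (6 * \sum_(0 <= i < s) (al - i) + s * (al.+1 < s) <= 3 * s * (al + (al - s.-1)))%N.
Proof.
move=> al0 s2; rewrite (_ : 6 = 3 * 2)%N // -mulnA sum_trunc //.
have [h|h] := leqP s al.+1; last by rewrite (minn_idPr _); nia.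
have [h2|h2] := leqP s al; first by nia.
have -> : s = al.+1 by lia.
nia.
Qed.

Lemma card_zone_vertices l : (0 < l)%N -> (#|` zone_vertices R l| <= 6 * l)%N.
Proof.
move=> l0; set V := vertices R l.-1.
pose z p := (#|` In p| < l)%N && (l.+1 < #|` In p| + #|` On p|)%N.
have -> : #|` zone_vertices R l| = (\sum_(p <- V) z p)%N.
  have -> : zone_vertices R l = [fset p in V | z p].
    apply/fsetP => p; rewrite in_zone_vertices in_sep in_vertices /z.
    by move: #|` In p| #|` On p| => m n; lia.
  rewrite card_sep -sum1_count big_mkcond /=.
  by apply: eq_bigr => p _; case: (z p).
pose g p := ((l - (#|` In p| + #|` onside 1 e p|)) +
             (l - (#|` In p| + #|` onside (-1) e p|)))%N.
pose f p := ((l - #|` In p|) + (l - (#|` In p| + #|` On p|).-1))%N.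
have h1 := balance_sum l0; rewrite -/V in h1.
have sum_g p : p \in V -> (\sum_(v <- On p) g (trans p v) =
    2 * \sum_(0 <= i < #|` On p|) (l - #|` In p| - i))%N.
  move=> pV; set s := #|` On p|.
  transitivity (\sum_(v <- On p) ((l - #|` In p| - rank p v) +
      (l - #|` In p| - (s.-1 - rank p v))))%N.
    apply: eq_big_seq => v vO; rewrite /g.
    have [-> _] := card_trans vO; have [-> ->] := card_onside_trans vO.
    by rewrite !subnDA.
  rewrite (sum_rank p (fun r => (l - #|` In p| - r) + (l - #|` In p| - (s.-1 - r)))%N).
  rewrite -/s big_split /= mul2n -addnn; congr addn.
  rewrite big_nat_rev /=; apply: eq_big_nat => i /andP[_ hi]; congr subn; lia.
have gap p : p \in V -> (z p)%:R / 3 + (\sum_(v <- On p) g (trans p v))%N%:R / (#|` On p|)%:R <=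
    (f p)%:R :> rat.
  move=> pV; have := pV; rewrite in_vertices => /andP[s2 jl].
  have al0 : (0 < l - #|` In p|)%N by rewrite subn_gt0; lia.
  have s0 : 0 < (#|` On p|)%:R :> rat by rewrite ltr0n; lia.
  rewrite sum_g // -(ler_pM2r s0) mulrDl mulfVK ?gt_eqF //.
  have := average_gap al0 s2.
  have -> : ((l - #|` In p|).+1 < #|` On p|)%N = z p.
    by rewrite /z; move: s2 jl al0; move: #|` On p| #|` In p| => m n; lia.
  have -> : (l - #|` In p| + (l - #|` In p| - #|` On p|.-1) = f p)%N.
    by rewrite /f; move: s2; move: #|` On p| #|` In p| => m n; lia.
  set S := (\sum_(0 <= i < #|` On p|) (l - #|` In p| - i))%N.
  move: S (f p) (z p : nat) #|` On p| => S F Z s h.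
  have : 6 * S%:R + s%:R * Z%:R <= 3 * s%:R * F%:R :> rat.
    by rewrite -!natrM -natrD ler_nat.
  rewrite natrM; lra.
have h2 : \sum_(p <- V) (f p)%:R <= 2 * l%:R + \sum_(p <- V) (g p)%:R :> rat.
  by rewrite -!natr_sum -natrM -natrD ler_nat.
have h3 : \sum_(p <- V) ((z p)%:R / 3) + \sum_(p <- V) (g p)%:R <= \sum_(p <- V) (f p)%:R :> rat.
  rewrite (trans_sum l.-1 g) -big_split /= big_seq [leRHS]big_seq.
  by apply: ler_sum => p pV; exact: gap.
rewrite -(ler_nat rat) natr_sum natrM.
move: h2 h3; rewrite -mulr_suml; lra.
Qed.

End UpperBound.

(** * The lower bound *)

Section LowerBound.
Variable R : realType.
Implicit Types (x y p q d e : R * R) (a b t u v w : int * int) (A B : {fset int * int}).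

Definition midpoint a : R * R := (a.1%:~R / 2, a.2%:~R / 2).

(* Walking along the bisector of [0] and [a], the vertex is the last point
   before the level stays at least [l]. *)
Lemma bisector_vertex l a : a != (0, 0) -> (#|` In (midpoint a)| < l)%N ->
  exists2 p, p \in zone_vertices R l & a \in On p.
Proof.
move=> a0 hl; pose d : R * R := (- a.2%:~R, a.1%:~R).
pose X r := along (midpoint a) d r.
have da : dot d a = 0 by rewrite /dot /d /=; ring.
have aX r : pow (X r) a = 0.
  by rewrite /X pow_along da mulr0 addr0 /pow /dot /midpoint /gnorm /=; field.
pose S := [set r : R | 0 <= r /\ (#|` In (X r)| < l)%N]%classic.
have S0 : S 0.
  split=> //; suff -> : X 0 = midpoint a by [].
  by rewrite /X /along !mul0r !addr0 /midpoint.
have Sub r : S r -> r <= 2 * l%:R.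
  case=> r0 hr; have l0 : (0 < l)%N by apply: leq_trans hr.
  have : (#|` In (X r)| < l ^ 2)%N by apply: leq_trans hr _; rewrite -mulnn leq_pmull.
  move/norm_bound => h; rewrite -ler_sqr ?nnegrE ?mulr_ge0 //.
  have a2 : (1 : R) <= (gnorm a)%:~R.
    by rewrite ler1z -gtz0_ge1 lt0r gnorm_eq0 a0 gnorm_ge0.
  have e : (X r).1 ^+ 2 + (X r).2 ^+ 2 = (1 / 4 + r ^+ 2) * (gnorm a)%:~R.
    by rewrite /X /along /midpoint /d /gnorm /=; field.
  rewrite e in h; have h1 : r ^+ 2 <= (1 / 4 + r ^+ 2) * (gnorm a)%:~R.
    have r2 := sqr_ge0 r; apply: (@le_trans _ _ ((1 / 4 + r ^+ 2) * 1)); first lra.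
    by apply: ler_wpM2l => //; lra.
  apply: le_trans h1 (le_trans h _); rewrite exprMn.
  by apply: ler_wpM2r; [exact: sqr_ge0|rewrite expr2; lra].
have hS : has_sup S by split; [exists 0|exists (2 * l%:R)].
pose r0 := sup S; pose p := X r0.
have r00 : 0 <= r0 by apply: ub_le_sup => //; case: hS.
have aO : a \in On p by rewrite in_On aX.
exists p => //; rewrite in_zone_vertices; apply/andP; split.
  (* The supremum need not be approached through [r0] itself: a short step back from [p] keeps its
     inner points inner, so the level of [p] is at most that of a point below [l]. *)
  have [t0 t0_gt0 ht] := In_On_along p (- d.1, - d.2).
  have [r [hr0 hr] hlt] := sup_adherent t0_gt0 hS.
  have rle : r <= r0 by apply: ub_le_sup; [case: hS|split].
  apply: leq_ltn_trans hr.
  have [er|rne] := eqVneq r r0; first by rewrite /p -er.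
  have hrr : 0 < r0 - r <= t0.
    rewrite subr_gt0 lt_neqAle rne rle /=; move: hlt; rewrite -/r0; lra.
  have [hI _] := ht _ hrr.
  have -> : X r = along p (- d.1, - d.2) (r0 - r).
    by rewrite /p /X /along /=; congr pair; ring.
  by rewrite hI; apply: fsubset_leq_card; exact: fsubsetUl.
have [t0 t0_gt0 ht] := In_On_along p d.
have /ht[hI _] : 0 < t0 <= t0 by rewrite t0_gt0 lexx.
have hX : X (r0 + t0) = along p d t0 by rewrite /p /X /along /=; congr pair; ring.
have hge : (l <= #|` In (along p d t0)|)%N.
  rewrite leqNgt; apply/negP => hlt.
  have : r0 + t0 <= r0.
    by apply: ub_le_sup; [case: hS|split; [rewrite addr_ge0 // ltW|rewrite hX]].
  by rewrite gerDl leNgt t0_gt0.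
(* Just beyond [p] the level is at least [l]. The points gained there lie on the circle but differ
   from the origin and from [a], since [d] runs along the bisector of [a]; this gives
   [l <= j + m - 1]. *)
have hsub : [fset b in On p | 0 < dot d b] `<=` On p `\ (0, 0) `\ a.
  apply/fsubsetP => b; rewrite in_sep !in_fsetD1 => /andP[-> hb]; rewrite andbT.
  apply/andP; split; apply: contraTneq hb => ->; first by rewrite da ltxx.
  by rewrite /dot /= !mulr0 addr0 ltxx.
have c2 : #|` On p| = #|` On p `\ (0, 0) `\ a|.+2.
  by rewrite (cardfsD1 (0, 0)) zero_On (cardfsD1 a (On p `\ _)) in_fsetD1 a0 aO.
rewrite c2 !addnS !ltnS; apply: leq_trans hge _.
rewrite hI -card_InU; last by apply/fsubsetP => b; rewrite !in_fsetD1 => /and3P[].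
by apply: fsubset_leq_card; apply: fsetUS.
Qed.

Lemma size_int_range n : size (int_range n) = n.*2.+1.
Proof. by rewrite size_map size_iota. Qed.

Lemma card_box n : #|` box n| = (n.*2.+1 ^ 2)%N.
Proof.
rewrite -mulnn -size_int_range -(size_allpairs pair); apply/perm_size/uniq_perm.
- exact: fset_uniq.
- by rewrite allpairs_uniq ?int_range_uniq // => -[? ?] [? ?].
- exact: seq_fsetE.
Qed.

(** The circle around the midpoint has the segment from the origin to [a] as a diameter, so its
    inner points lie in the box of twice the size; the origin is in that box but is not inner. *)
Lemma In_midpoint_lt n a : a \in box n -> (#|` In (midpoint a)| < (4 * n).+1 ^ 2)%N.
Proof.
move=> an; rewrite (_ : (4 * n).+1 = (2 * n).*2.+1)%N; last by lia.
rewrite -card_box; apply: fproper_ltn_card; rewrite fproperE; apply/andP; split; last first.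
  by apply/fsubsetPn; exists (0, 0); rewrite ?zero_In // in_box normr0.
apply/fsubsetP => b; rewrite in_In.
have -> : pow (midpoint a) b = (a.1 * b.1 + a.2 * b.2 - gnorm b)%:~R.
  by rewrite /pow /dot /midpoint /gnorm /=; field.
rewrite ltr0z subr_gt0 /gnorm in_box; move: an; rewrite in_box; case: a b => a1 a2 [b1 b2] /=.
move=> /andP[h1 h2] h.
have key (c1 c2 : int) : `|c1| <= n%:Z -> `|c2| <= n%:Z -> c1 ^+ 2 + c2 ^+ 2 <= (2 * n%:Z) ^+ 2.
  by move=> ? ?; nia.
have hk := key _ _ h1 h2.
have hs : (2 * b1 - a1) ^+ 2 + (2 * b2 - a2) ^+ 2 <= (2 * n%:Z) ^+ 2.
  by apply: le_trans hk; move: h; rewrite !expr2; nia.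
have fin (u v : int) : u ^+ 2 + v ^+ 2 <= (2 * n%:Z) ^+ 2 -> `|u| <= 2 * n%:Z.
  move=> huv; rewrite -ler_sqr ?nnegrE // real_normK ?num_real //.
  by apply: le_trans huv; rewrite lerDl sqr_ge0.
have f1 := fin _ _ hs; rewrite addrC in hs; have f2 := fin _ _ hs.
by rewrite PoszM; move: f1 f2 h1 h2; clear; lia.
Qed.

Lemma In_midpoint_unit : In (midpoint (1, 0)) = fset0.
Proof.
apply/fsetP => b; rewrite in_In in_fset0; apply/negbTE.
have -> : pow (midpoint (1, 0)) b = (b.1 - gnorm b)%:~R.
  by rewrite /pow /dot /midpoint /gnorm /=; field.
by rewrite ltr0z /gnorm; case: b => b1 b2 /=; nia.
Qed.

Lemma many_bisectors l : (0 < l)%N -> exists s : seq (int * int),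
  [/\ uniq s, (l <= 25 * size s)%N &
      forall a, a \in s -> a != (0, 0) /\ (#|` In (midpoint a)| < l)%N].
Proof.
(* The case [n = 1] of [(4 n + 1)^2 <= l] starts at 25. Below that a single bisector suffices; above
   it, the largest such [n] gives a box with enough points. *)
move=> l0; have [l25|l25] := ltnP l 25.
  exists [:: (1, 0)]; split=> //; first by rewrite /= muln1 ltnW.
  by move=> a; rewrite inE => /eqP ->; rewrite In_midpoint_unit cardfs0.
have ex : exists n, ((4 * n).+1 ^ 2 <= l)%N by exists 1%N.
have [|n hn hmax] := @ex_maxnP (fun n => ((4 * n).+1 ^ 2 <= l)%N) l ex.
  by move=> n; rewrite -mulnn; nia.
have n0 : (0 < n)%N by apply: hmax.
exists (box n `\ (0, 0)); split; first exact: fset_uniq.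
  have : ~~ ((4 * n.+1).+1 ^ 2 <= l)%N by apply/negP => /hmax; rewrite ltnn.
  have := cardfsD1 (0, 0) (box n); rewrite in_box normr0 /= card_box.
  by move: #|` _ `\ _| => m; rewrite -!mulnn -ltnNge; nia.
move=> a; rewrite in_fsetD1 => /andP[a0 an]; split=> //.
by apply: leq_trans (In_midpoint_lt an) hn.
Qed.

Lemma sqrt_nat l : exists2 M : nat, (l <= M ^ 2)%N & (0 < l -> M ^ 2 <= 4 * l)%N.
Proof.
have ex : exists M, (l <= M ^ 2)%N by exists l; rewrite -mulnn; nia.
exists (ex_minn ex); case: ex_minnP => // M h hmin l0.
case: M h hmin => [|M] h hmin; first by [].
have : ~~ (l <= M ^ 2)%N by apply/negP => /hmin; rewrite ltnn.
by move: h; rewrite -!mulnn -ltnNge; case: M {hmin} => [|M]; nia.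
Qed.

(* Scaling a circle through three lattice points by twice the area [D] that
   their difference vectors span moves its centre to a lattice point, so that
   the lattice points on the circle give representations of an integer of
   polynomial size as a sum of two squares. *)
Lemma card_On_reps l p : (0 < l)%N -> p \in zone_vertices R l ->
  exists n : nat, [/\ (0 < n)%N, (n <= 2 ^ 13 * 4 ^ 3 * l ^ 3)%N & (#|` On p| <= size (reps n))%N].
Proof.
move=> l0; rewrite in_zone_vertices => /andP[h1 h2].
have h3 : (2 < #|` On p|)%N by move: h1 h2; move: #|` In p| #|` On p| => m n; lia.
have [a [b [aO bO a0 b0 ab]]] := three_points h3 (zero_On p).
have [M hM hM'] := sqrt_nat l; have {}hM' := hM' l0.
have pM : p.1 ^+ 2 + p.2 ^+ 2 <= 2 * M%:R ^+ 2.
  by apply: norm_bound; apply: leq_trans h1 hM.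
have inbox c : c \in On p -> c \in box (4 * M).
  by rewrite in_On => /eqP pc; apply: (norm_box pM); rewrite pc.
pose D : int := 2 * (a.1 * b.2 - a.2 * b.1).
pose u : int * int := (gnorm a * b.2 - gnorm b * a.2, gnorm b * a.1 - gnorm a * b.1).
have D0 : D != 0.
  rewrite mulf_eq0 /= -(intr_eq0 R) rmorphB !rmorphM /=.
  by apply: contra_not_neq (elimN eqP ab) => h; apply: (On_crs aO bO).
have Dr : D%:~R = 2 * crs (emb R a) (emb R b) by rewrite /D /crs /emb /=; ring.
have D0r : D%:~R != 0 :> R by rewrite intr_eq0.
have pu1 : D%:~R * p.1 = u.1%:~R.
  rewrite Dr /u /= rmorphB !rmorphM /= -(On_dot aO) -(On_dot bO) /crs /dot /emb /=; ring.
have pu2 : D%:~R * p.2 = u.2%:~R.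
  rewrite Dr /u /= rmorphB !rmorphM /= -(On_dot aO) -(On_dot bO) /crs /dot /emb /=; ring.
have gu : (gnorm u)%:~R = D%:~R ^+ 2 * (p.1 ^+ 2 + p.2 ^+ 2) :> R.
  by rewrite /gnorm rmorphD !rmorphXn /= -pu1 -pu2; ring.
exists (absz (gnorm u)).
have gu0 : 0 < gnorm u.
  rewrite -(ltr0z R) gu mulr_gt0 ?(On_norm_gt0 aO a0) //.
  by rewrite lt0r sqrf_eq0 D0r sqr_ge0.
have zu : (absz (gnorm u))%:Z = gnorm u by rewrite gtz0_abs.
split; first by rewrite absz_gt0 gt_eqF.
  rewrite -lez_nat zu -(ler_int R) gu -pmulrn.
  (* Coordinates of [a] and [b] are at most [4 M], whence 64. The integer is
     [D^2 |p|^2 <= 2^12 M^4 * 2 M^2], and [M^2 <= 4 l] gives the stated constants. *)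
  have hD : `|D| <= (64 * M ^ 2)%N%:Z.
    have := inbox a aO; have := inbox b bO; rewrite !in_box /D.
    move: a b {aO bO a0 b0 ab D D0 Dr D0r u pu1 pu2 gu gu0 zu} => [a1 a2] [b1 b2] /=.
    by move=> /andP[? ?] /andP[? ?]; rewrite -mulnn; nia.
  have hD2 : D%:~R ^+ 2 <= (64 * M%:R ^+ 2) ^+ 2 :> R.
    rewrite -[D%:~R ^+ 2]real_normK ?num_real // ler_sqr ?nnegrE ?mulr_ge0 ?sqr_ge0 //.
    rewrite -intr_norm -natrX -natrM pmulrn ler_int; exact: hD.
  apply: le_trans (ler_pM (sqr_ge0 _) _ hD2 pM) _; first by rewrite addr_ge0 ?sqr_ge0.
  have -> : (64 * M%:R ^+ 2) ^+ 2 * (2 * M%:R ^+ 2) = (2 ^ 13 * (M ^ 2) ^ 3)%N%:R :> R.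
    by rewrite natrM !natrX; ring.
  by rewrite ler_nat -mulnA leq_mul2l -expnMn leq_exp2r // hM' orbT.
clearbody u D; pose f c : int * int := (D * c.1 - u.1, D * c.2 - u.2).
have finj : injective f.
  by move=> [c1 c2] [d1 d2] [] /addIr/(mulfI D0) -> /addIr/(mulfI D0) ->.
rewrite -(size_map f); apply: uniq_leq_size; first by rewrite map_inj_uniq ?fset_uniq.
move=> _ /mapP[c cO ->]; rewrite mem_reps zu -(eqr_int R) gu; apply/eqP.
have hc : c.1%:~R ^+ 2 + c.2%:~R ^+ 2 = 2 * (p.1 * c.1%:~R + p.2 * c.2%:~R) :> R.
  have := On_dot cO; rewrite /dot => ->; by rewrite /gnorm rmorphD !rmorphXn.
rewrite /gnorm rmorphD !rmorphXn /= !rmorphB !rmorphM /= -pu1 -pu2.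
transitivity (D%:~R ^+ 2 * (p.1 ^+ 2 + p.2 ^+ 2 + (c.1%:~R ^+ 2 + c.2%:~R ^+ 2
   - 2 * (p.1 * c.1%:~R + p.2 * c.2%:~R))) : R); first ring.
by rewrite hc subrr addr0.
Qed.

(** In effect the number of vertices is at least a constant times [l^(1 - 3/M)]: the represented
    integer is [O(l^3)], so a vertex lies on [O(l^(3/M))] bisectors. *)
Lemma zone_vertices_lower (M : nat) : (0 < M)%N -> exists2 C : nat, (0 < C)%N &
  forall l, (0 < l)%N -> (l.+1 ^ M <= C * #|` zone_vertices R l| ^ M * l.+1 ^ 3)%N.
Proof.
move=> M0; have [C C0 hC] := size_reps_bound M0.
exists (50 ^ M * (C * (2 ^ 13 * 4 ^ 3)))%N; first by rewrite !muln_gt0 C0 !expn_gt0.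
move=> l l0; pose B := (C * (2 ^ 13 * 4 ^ 3 * l ^ 3))%N.
have ex : exists n, (n ^ M <= B)%N by exists 0%N; rewrite exp0n.
have [|X hX hmax] := @ex_maxnP (fun n => (n ^ M <= B)%N) B ex.
  move=> n h; apply: leq_trans h; case: (n) => // m.
  by rewrite -[leqLHS]expn1 leq_pexp2l.
have hOn p : p \in zone_vertices R l -> (#|` On p| <= X)%N.
  move=> pZ; have [n [n0 hn hp]] := card_On_reps l0 pZ.
  apply: hmax; apply: leq_trans (_ : size (reps n) ^ M <= _)%N; first by rewrite leq_exp2r.
  by apply: leq_trans (hC n n0) _; rewrite leq_mul2l hn orbT.
have [s [us hs ha]] := many_bisectors l0.
pose Z := zone_vertices R l.
have hsz : (size s <= #|` Z| * X)%N.
  pose F := flatten [seq (On p : seq _) | p <- Z].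
  apply: (@leq_trans (size F)).
    apply: uniq_leq_size us _ => a /ha[a0 al].
    have [p pZ aO] := bisector_vertex a0 al.
    by apply/flattenP; exists (On p : seq _) => //; apply/mapP; exists p.
  rewrite size_flatten /shape -map_comp sumnE big_map.
  apply: (@leq_trans (\sum_(p <- Z) X)); last first.
    by rewrite big_const_seq count_predT iter_addn_0 mulnC.
  by rewrite big_seq [leqRHS]big_seq; apply: leq_sum => p pZ; exact: hOn.
(* The constant is 25 from [many_bisectors], doubled by [l + 1 <= 2 l]. *)
have h1 : (l.+1 <= 50 * (#|` Z| * X))%N by move: hs hsz; nia.
apply: (@leq_trans ((50 * (#|` Z| * X)) ^ M)); first by rewrite leq_exp2r.
rewrite !expnMn; move: hX; rewrite /B.
have : (l ^ 3 <= l.+1 ^ 3)%N by rewrite leq_exp2r.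
move: (50 ^ M)%N (#|` Z| ^ M)%N (X ^ M)%N (l ^ 3)%N (l.+1 ^ 3)%N (2 ^ 13 * 4 ^ 3)%N.
move=> q z x r r' t hr hx.
rewrite -!mulnA leq_mul2l; apply/orP; right.
apply: (@leq_trans (z * (C * (t * r'))))%N; last by apply/eq_leq; ring.
rewrite leq_mul2l; apply/orP; right; apply: leq_trans hx _.
by rewrite leq_mul2l leq_mul2l hr !orbT.
Qed.

End LowerBound.

(** * Brillouin zones *)

Local Open Scope classical_set_scope.
Local Open Scope card_scope.
Local Open Scope ring_scope.

Section Chambers.
Variable R : realType.
Implicit Types (x y : 'rV[R]_2) (a b : 'rV[int]_2) (A B : {fset int * int}).

Definition coords (T : Type) (x : 'rV[T]_2) : T * T := (x 0 0, x 0 1).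

Definition uncoords (T : Type) (p : T * T) : 'rV[T]_2 :=
  \row_i (if i == 0 then p.1 else p.2).

Lemma uncoordsK (T : Type) : cancel (@uncoords T) (@coords T).
Proof. by case=> u v; rewrite /coords !mxE. Qed.

Lemma coordsK (T : Type) : cancel (@coords T) (@uncoords T).
Proof.
move=> x; apply/rowP => i; rewrite mxE; case: (eqVneq i 0) => [-> //|i0].
by congr (x 0 _); apply/val_inj => /=; case: i i0 => -[|[|i]].
Qed.

Lemma coords_eq0 a : (coords a == (0, 0)) = (a == 0).
Proof.
apply/eqP/eqP => [h|->]; last by rewrite /coords !mxE.
by rewrite -[a]coordsK h; apply/rowP => i; rewrite !mxE; case: ifP.
Qed.

Lemma sumsq_pow x a : \sum_(i < 2) (x - lattice_pt R a) 0 i ^+ 2 =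
  \sum_(i < 2) x 0 i ^+ 2 - pow (coords x) (coords a).
Proof.
rewrite !big_ord_recl !big_ord0 !addr0 pow_sqr /coords /= !mxE.
have -> : lift ord0 ord0 = 1 :> 'I_2 by apply: val_inj.
by ring.
Qed.

Lemma sumsq_ge0 x : 0 <= \sum_(i < 2) x 0 i ^+ 2.
Proof. by apply: sumr_ge0 => i _; exact: sqr_ge0. Qed.

Lemma enorm_le x a : (enorm (x - lattice_pt R a) <= enorm x) = (0 <= pow (coords x) (coords a)).
Proof.
by rewrite /enorm ler_psqrt ?nnegrE ?sumsq_ge0 // sumsq_pow gerBl.
Qed.

Lemma enorm_ge x a : (enorm x <= enorm (x - lattice_pt R a)) = (pow (coords x) (coords a) <= 0).
Proof.
by rewrite /enorm ler_psqrt ?nnegrE ?sumsq_ge0 // sumsq_pow lerBrDr gerDl.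
Qed.

Lemma enorm_lt x a : (enorm (x - lattice_pt R a) < enorm x) = (0 < pow (coords x) (coords a)).
Proof. by rewrite !ltNge enorm_ge. Qed.

Lemma bisectorE x a : bisector R a x <-> pow (coords x) (coords a) = 0.
Proof.
rewrite /bisector /=; split=> [h|h].
  by apply/eqP; rewrite eq_le -enorm_ge -enorm_le h lexx.
by apply/eqP; rewrite eq_le enorm_ge enorm_le h lexx.
Qed.

Lemma off_bisectorsE x : off_bisectors R x <-> exists A, cell A (coords x).
Proof.
split=> [h|[A /cellP[_ hA]] [a a0 /bisectorE h]].
  exists (In (coords x)); split=> //; apply/fsetP => a; rewrite in_fset1.
  have [->|a0] := eqVneq a (0, 0); first exact: zero_On.
  apply/negbTE/negP; rewrite in_On => /eqP pa; apply: h.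
  exists (uncoords a); first by rewrite /= -coords_eq0 uncoordsK.
  by apply/bisectorE; rewrite uncoordsK.
have := hA (coords a); rewrite coords_eq0 h ltxx => /(_ a0).
by case: ifP.
Qed.

Definition cell_set A : set 'rV[R]_2 := [set x | cell A (coords x)].

Lemma cell_set_off A : cell_set A `<=` off_bisectors R.
Proof. by move=> x hx; apply/off_bisectorsE; exists A. Qed.

Lemma continuous_coords : continuous (@coords R).
Proof.
move=> x; exact: (cvg_pair (G := nbhs (x 0 0)) (H := nbhs (x 0 1))
  (@coord_continuous R 1 2 0 0 x) (@coord_continuous R 1 2 0 1 x)).
Qed.

Lemma continuous_pow_coords (a : int * int) :
  continuous (fun x : 'rV[R]_2 => pow (coords x) a).
Proof.
move=> x.
exact: (continuous_comp (@continuous_coords x) (@continuous_pow R a (coords x))).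
Qed.

(** On a connected set off the bisectors no power vanishes at a nonzero lattice point, so none
    changes sign; conversely a cell is convex, and a segment joins [x] to each of its points. *)
Lemma component_cell A x : cell A (coords x) ->
  connected_component (off_bisectors R) x = cell_set A.
Proof.
move=> hx; apply/seteqP; split=> y.
  move=> hy; pose D := connected_component (off_bisectors R) x.
  have Doff : D `<=` off_bisectors R by exact: connected_component_sub.
  have Dx : D x by apply: connected_component_refl; exact: cell_set_off hx.
  have /cellP[A0 hA] := hx; apply/cellP; split=> // a a0.
  have itv : is_interval [set pow (coords z) a | z in D].
    apply/connected_intervalP; apply: connected_continuous_connected.
      exact: component_connected.
    by apply: continuous_subspaceT; exact: continuous_pow_coords.
  have no0 : ~ [set pow (coords z) a | z in D] 0.
    move=> [z /Doff hz h]; apply: hz; exists (uncoords a).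
      by rewrite /= -coords_eq0 uncoordsK.
    by apply/bisectorE; rewrite uncoordsK.
  have hxI : [set pow (coords z) a | z in D] (pow (coords x) a) by exists x.
  have hyI : [set pow (coords z) a | z in D] (pow (coords y) a) by exists y.
  have := hA a a0; case: ifP => _ hxa; rewrite ltNge; apply/negP => hya; apply: no0.
    by apply: (itv _ _ hyI hxI); rewrite hya ltW.
  by apply: (itv _ _ hxI hyI); rewrite hya ltW.
move=> hy; pose g (t : R) : 'rV[R]_2 := x + t *: (y - x).
have gc : continuous g.
  by move=> t; apply: cvgD; [exact: cvg_cst|apply: cvgZr_tmp; exact: cvg_id].
apply: (@connected_component_max _ _ (g @` `[0, 1])).
- exists 0; first by rewrite /= in_itv /= lexx ler01.
  by rewrite /g scale0r addr0.
- move=> _ [t + <-]; rewrite /= in_itv /= => /andP[t0 t1]; apply: (@cell_set_off A).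
  rewrite /cell_set /=; have [t00|tn0] := eqVneq t 0.
    by rewrite /g t00 scale0r addr0.
  have -> : coords (g t) = along (coords x)
     ((coords y).1 - (coords x).1, (coords y).2 - (coords x).2) t.
    by rewrite /g /coords /along /= !mxE.
  by apply: (cell_mix hy (cell_closed hx)); rewrite lt0r tn0 t0 t1.
- apply: connected_continuous_connected; first exact: segment_connected.
  exact: continuous_subspaceT.
exists 1; first by rewrite /= in_itv /= lexx ler01.
by rewrite /g scale1r addrC subrK.
Qed.

Lemma chambersE : chambers R = [set closure (cell_set A) | A in [set A | exists x, cell_set A x]].
Proof.
apply/seteqP; split=> [_ [x /off_bisectorsE[A hx] <-]|_ [A [x hx] <-]].
  by exists A; [exists x|rewrite (component_cell hx)].
by exists x; [exact: cell_set_off hx|rewrite (component_cell hx)].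
Qed.

Lemma closure_cell A x : closure (cell_set A) x -> closed_cell A (coords x).
Proof.
have cl : closed (@coords R @^-1` closed_cell A).
  by apply: closed_comp => [y _|]; [exact: continuous_coords|exact: closed_closed_cell].
move=> hx; apply: cl; apply: closure_subset hx => y; exact: cell_closed.
Qed.

(** Chambers are closures, so distinct cells must keep distinct closures: the strict signs at a
    point of one cell contradict the weak signs of the other. *)
Lemma closure_cell_inj A B x : cell_set A x ->
  closure (cell_set A) = closure (cell_set B) -> (0, 0) \notin B -> A = B.
Proof.
move=> hx e B0; have /cellP[A0 hA] := hx.
have hB : closed_cell B (coords x).
  by apply: closure_cell; rewrite -e; exact: subset_closure.
apply/fsetP => a; have [->|a0] := eqVneq a (0, 0).
  by rewrite (negPf A0) (negPf B0).
have [h1 h2] := hB a; have := hA a a0.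
case: (boolP (a \in A)) => _; case: (boolP (a \in B)) => // aB h.
  by have := h2 aB; rewrite leNgt h.
by have := h1 aB; rewrite leNgt h.
Qed.

Lemma card_coords A : [set a : 'rV[int]_2 | coords a \in A] #= `I_(#|` A|).
Proof.
have -> : [set a | coords a \in A] = @uncoords int @` [set` A].
  apply/seteqP; split=> [a aA|_ [b bA <-]] /=; last by rewrite uncoordsK.
  by exists (coords a); rewrite ?coordsK.
apply: card_eq_trans (_ : [set` A] #= _); last exact/card_eq_fsetP.
by apply: inj_card_eq => u v _ _; exact: (can_inj (@uncoordsK int)).
Qed.

Lemma brillouin_zoneE k x : brillouin_zone R k x <->
  (#|` In (coords x)| <= k.-1)%N /\
  (k.-1 <= #|` (In (coords x) `|` On (coords x)) `\ (0, 0)%R|)%fset%N.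
Proof.
rewrite /brillouin_zone /=.
have -> : [set a | a != 0 /\ enorm (x - lattice_pt R a) < enorm x] =
    [set a | coords a \in In (coords x)].
  apply/seteqP; split=> a /=; rewrite in_In enorm_lt; first by case.
  move=> h; split=> //; rewrite -coords_eq0; apply: contraTneq h => ->.
  by rewrite pow0 ltxx.
have -> : [set b | b != 0 /\ enorm (x - lattice_pt R b) <= enorm x] =
    [set b | coords b \in ((In (coords x) `|` On (coords x)) `\ (0, 0)%R)%fset].
  apply/seteqP; split=> a /=; rewrite in_fsetD1 in_fsetU in_In in_On coords_eq0 enorm_le le_eqVlt.
    by move=> [-> /orP[/eqP<-|->]]; rewrite ?eqxx ?orbT.
  by move=> /andP[-> /orP[->|/eqP->]]; rewrite ?eqxx ?orbT.
by rewrite (card_le_eql (card_coords _)) (card_le_eqr (card_coords _)) !card_le_II.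
Qed.

Lemma brillouin_chambersE k : brillouin_chambers R k =
  [set closure (cell_set A) | A in [set` cells R k.-1]].
Proof.
rewrite /brillouin_chambers chambersE; apply/seteqP; split=> C /=.
  move=> [[A [x hx] <-] hC]; exists A => //; apply/in_cells; split.
    by exists (coords x).
  have /brillouin_zoneE[h1 h2] := hC x (subset_closure hx).
  have [eA eO] := hx; rewrite eA in h1 h2; apply/eqP; rewrite eqn_leq h1 /=.
  apply: leq_trans h2 _; apply: fsubset_leq_card; apply/fsubsetP => a.
  by rewrite eO in_fsetD1 in_fsetU in_fset1 => /andP[/negPf ->]; rewrite orbF.
move=> [A /in_cells[[p hp] hA] <-]; split.
  by exists A => //; exists (uncoords p); rewrite /cell_set /= uncoordsK.
move=> x /closure_cell/closed_cellE[h1 h2]; apply/brillouin_zoneE; rewrite -hA; split.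
  exact: fsubset_leq_card.
apply: fsubset_leq_card; apply/fsubsetP => a aA; rewrite in_fsetD1 (fsubsetP h2 a aA) andbT.
by apply: contraTneq aA => ->; exact: cell0 hp.
Qed.

Lemma card_brillouin_chambers k : brillouin_chambers R k #= `I_(#|` cells R k.-1|).
Proof.
rewrite brillouin_chambersE; apply: card_eq_trans (_ : [set` cells R k.-1] #= _).
  apply: inj_card_eq => A B /set_mem/in_cells[[p hp] _] /set_mem/in_cells[[q hq] _] e.
  apply: (@closure_cell_inj A B (uncoords p)) => //; last exact: cell0 hq.
  by rewrite /cell_set /= uncoordsK.
exact/card_eq_fsetP.
Qed.

End Chambers.

Theorem theorem5p2 (R : realType) (eps : R) (eps_gt0 : 0 < eps) :
  exists2 c : R, 0 < c &
    forall k : nat, (2 <= k)%N ->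
      exists chi : nat,
        [/\ brillouin_chambers R k #= `I_chi,
            c * k%:R `^ (1 - eps) <= chi%:R
          & (chi <= 6 * k - 6)%N].
Proof.
(* This makes [(1 - eps) M + 3 <= M], which absorbs the factor [k^3]; the successor keeps [M]
   positive. *)
pose M := (Num.bound (3 / eps)).+1.
have hM : 3 <= eps * M%:R.
  rewrite mulrC -ler_pdivrMr //; apply/ltW; apply: (lt_le_trans (archi_boundP _)).
    by rewrite divr_ge0 // ltW.
  by rewrite ler_nat.
have [C C0 hC] := @zone_vertices_lower R M isT.
have Cr : 0 < C%:R :> R by rewrite ltr0n.
exists C%:R^-1; first by rewrite invr_gt0.
move=> k k2; have k1 : (0 < k.-1)%N by lia.
exists #|` cells R k.-1|; rewrite card_cells //; split.
- by rewrite -card_cells //; exact: card_brillouin_chambers.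
- have kE : k.-1.+1 = k by lia.
  set Z := #|` _|; have := hC k.-1 k1; rewrite -/Z kE => h.
  have kR : 1 <= k%:R :> R by rewrite ler1n; lia.
  rewrite -(@ler_pXn2r _ M) ?nnegrE ?mulr_ge0 ?invr_ge0 ?powR_ge0 ?ler0n //.
  rewrite exprMn -[(k%:R `^ _) ^+ M]powR_mulrn ?powR_ge0 // -powRrM.
  have k3 : 0 < k%:R ^+ 3 :> R by rewrite exprn_gt0 // (lt_le_trans ltr01).
  have p3 : k%:R `^ ((1 - eps) * M%:R) * k%:R ^+ 3 <= k%:R ^+ M :> R.
    rewrite -!powR_mulrn ?ler0n // -powRD; last by apply/implyP => _; rewrite pnatr_eq0; lia.
    by apply: ler_powR => //; rewrite mulrBl mul1r; move: hM; lra.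
  have h' : k%:R ^+ M <= C%:R * Z%:R ^+ M * k%:R ^+ 3 :> R.
    by rewrite -!natrX -!natrM ler_nat.
  have h2 : k%:R `^ ((1 - eps) * M%:R) <= C%:R * Z%:R ^+ M :> R.
    by rewrite -(ler_pM2r k3); apply: le_trans p3 h'.
  (* The inequality is compared after raising to the power [M]. Since [C >= 1], one factor [C^-1]
     dominates its [M]-th power and cancels [C]. *)
  have CM : C%:R^-1 ^+ M <= C%:R^-1 :> R.
    rewrite exprSr ler_piMl ?invr_ge0 ?ler0n // exprn_ile1 ?invr_ge0 ?ler0n //.
    by rewrite invf_le1 // ler1n.
  apply: le_trans (ler_pM _ _ CM h2) _; rewrite ?exprn_ge0 ?invr_ge0 ?powR_ge0 ?ler0n //.
  by rewrite mulKf ?gt_eqF.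
by apply: leq_trans (card_zone_vertices R k1) _; lia.
Qed.
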